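(* Let $k,n\ge1$, $m=kn-1$, and let $g$ be the metric on $\mathbb P_m\mathbb C$ described in the context with $a_m=m+1$, $dv$ its volume element. For every $\alpha<1$ there exists a constant $C$ such that $$\int_{\mathbb P_m\mathbb C}e^{-\alpha\varphi}\,dv\le C$$ for every $\varphi\in C^\infty(\mathbb P_m\mathbb C)$ that is $g$-admissible, $G_{n,k}$-invariant, and satisfies $\sup_{\mathbb P_m\mathbb C}\varphi=0$.
   Context: Homogeneous coordinates on $\mathbb P_m\mathbb C$, $m=kn-1$, are written $[z_0,\dots,z_m]=[Z_0,\dots,Z_{k-1}]$ with blocks $Z_h=(z_{hn},\dots,z_{(h+1)n-1})\in\mathbb C^n$. The metric $g$ is $a_m$ times the Fubini–Study metric: in the chart $\{z_0=1\}$ its components are $g_{\lambda\bar\mu}=a_m\,\partial^2\ln(1+|z_1|^2+\cdots+|z_m|^2)/\partial z_\lambda\partial\bar z_\mu$. A function $\varphi\in C^\infty(\mathbb P_m\mathbb C)$ is $g$-admissible if $g_{\lambda\bar\mu}+\partial^2\varphi/\partial z_\lambda\partial\bar z_\mu$ is positive definite everywhere. $G_{n,k}$ is the group of automorphisms of $\mathbb P_m\mathbb C$ generated by: swaps of two blocks $Z_i,Z_j$; multiplication of a single homogeneous coordinate $z_p$ by $e^{i\theta}$; and transpositions of two coordinates $z_p,z_q$ lying in the same block $Z_h$. *)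

(* Defs.v *)
From HB Require Import structures.
From mathcomp Require Import all_boot all_order all_algebra.
From mathcomp Require Import all_classical all_reals all_analysis.
From mathcomp.real_closed Require Import complex.
Set Implicit Arguments. Unset Strict Implicit. Unset Printing Implicit Defensive.
Import Order.TTheory GRing.Theory Num.Theory.
Import numFieldNormedType.Exports.
Local Open Scope ring_scope.
Local Open Scope classical_set_scope.

(* Encoding.  A point of C^N is a real matrix Z : 'M[R]_(2, N); the complex  *)
(* coordinate z_c is  Z 0 c + i Z 1 c  (row 0 = real parts, row 1 = imag.).  *)
(* A function phi on P_{N-1}C is represented by Phi : 'M_(2,N) -> R, i.e.    *)
(* phi o pi on C^N \ {0}, which must be invariant under C^* scaling.         *)

Definition re_ix : 'I_2 := ord0.
Definition im_ix : 'I_2 := @Ordinal 2 1 isT.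

Fixpoint diter {R : realType} {p q : nat} (f : 'M[R]_(p, q) -> R)
    (vs : seq 'M[R]_(p, q)) : 'M[R]_(p, q) -> R :=
  match vs with
  | [::] => f
  | v :: vs' => fun x => 'D_v (diter f vs') x
  end.

Definition smooth_on {R : realType} {p q : nat} (D : set 'M[R]_(p, q))
    (f : 'M[R]_(p, q) -> R) : Prop :=
  forall vs : seq 'M[R]_(p, q),
    (forall (v x : 'M[R]_(p, q)), D x -> derivable (diter f vs) x v) /\
    (forall x, D x -> {for x, continuous (diter f vs)}).

Definition cscale {R : realType} {N : nat} (a b : R) (Z : 'M[R]_(2, N))
  : 'M[R]_(2, N) :=
  \matrix_(r, c) if r == re_ix then a * Z re_ix c - b * Z im_ix c
                 else a * Z im_ix c + b * Z re_ix c.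

Definition proj_invariant {R : realType} {N : nat} (Phi : 'M[R]_(2, N) -> R)
  : Prop :=
  forall (a b : R) (Z : 'M[R]_(2, N)), (a, b) != (0, 0) -> Z != 0 ->
    Phi (cscale a b Z) = Phi Z.

Definition chart {R : realType} {m : nat} (j : 'I_m.+1) (w : 'M[R]_(2, m))
  : 'M[R]_(2, m.+1) :=
  \matrix_(r, c) match unlift j c with
                 | Some c' => w r c'
                 | None => (r == re_ix)%:R
                 end.

Definition ex {R : realType} {m : nat} (l : 'I_m) : 'M[R]_(2, m) :=
  delta_mx re_ix l.
Definition ey {R : realType} {m : nat} (l : 'I_m) : 'M[R]_(2, m) :=
  delta_mx im_ix l.

(* complex Hessian  ( d^2 f / dz_l d zbar_mu )_{l,mu}  at w, with
   d/dz = (d/dx - i d/dy)/2 and d/dzbar = (d/dx + i d/dy)/2 *)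
Definition cplx_hessian {R : realType} {m : nat} (f : 'M[R]_(2, m) -> R)
    (w : 'M[R]_(2, m)) : 'M[R[i]]_m :=
  \matrix_(l, mu)
    Complex (('D_(ex l) ('D_(ex mu) f) w + 'D_(ey l) ('D_(ey mu) f) w) / 4)
            (('D_(ex l) ('D_(ey mu) f) w - 'D_(ey l) ('D_(ex mu) f) w) / 4).

Definition pos_def_herm {R : realType} {m : nat} (H : 'M[R[i]]_m) : Prop :=
  forall xi : 'rV[R[i]]_m, xi != 0 ->
    0 < \sum_(l < m) \sum_(mu < m) H l mu * xi 0 l * (xi 0 mu)^*.

Definition sqnorm {R : realType} {m : nat} (w : 'M[R]_(2, m)) : R :=
  \sum_(r < 2) \sum_(c < m) w r c ^+ 2.
Definition fs_potential {R : realType} {m : nat} (a : R) (w : 'M[R]_(2, m))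
  : R := a * ln (1 + sqnorm w).

(* g-admissible, with g = a * (Fubini-Study): in every affine chart
   {z_j = 1} and at every point, g_{l mu} + d^2 phi/dz_l dzbar_mu > 0. *)
Definition admissible {R : realType} {m : nat} (a : R)
    (Phi : 'M[R]_(2, m.+1) -> R) : Prop :=
  forall (j : 'I_m.+1) (w : 'M[R]_(2, m)),
    pos_def_herm
      (cplx_hessian (fun w' => fs_potential a w' + Phi (chart j w')) w).

Definition permZ {R : realType} {m : nat} (s : nat -> nat)
    (Z : 'M[R]_(2, m.+1)) : 'M[R]_(2, m.+1) :=
  \matrix_(r, c) Z r (inord (s c)).

Definition block_swap (n i j : nat) (p : nat) : nat :=
  if (p %/ n == i)%N then (j * n + p %% n)%N
  else if (p %/ n == j)%N then (i * n + p %% n)%N else p.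

Definition transp (p q : nat) (c : nat) : nat :=
  if c == p then q else if c == q then p else c.

Definition rotZ {R : realType} {m : nat} (p : nat) (theta : R)
    (Z : 'M[R]_(2, m.+1)) : 'M[R]_(2, m.+1) :=
  \matrix_(r, c)
    if (c : nat) == p then
      (if r == re_ix then cos theta * Z re_ix c - sin theta * Z im_ix c
       else sin theta * Z re_ix c + cos theta * Z im_ix c)
    else Z r c.

(* the (linear lifts of the) elements of G_{n,k}, acting on C^{kn}, where
   m.+1 = k n : closure of the generators under composition (this is the
   generated group: each generator has an inverse of the same kind). *)
Unset Implicit Arguments.
Inductive Gnk (R : realType) (k n m : nat)
  : ('M[R]_(2, m.+1) -> 'M[R]_(2, m.+1)) -> Prop :=
| Gnk_id : Gnk R k n m id
| Gnk_swap (i j : nat) : (i < k)%N -> (j < k)%N ->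
    Gnk R k n m (permZ (block_swap n i j))
| Gnk_rot (p : nat) (theta : R) : (p < m.+1)%N -> Gnk R k n m (rotZ p theta)
| Gnk_transp (p q : nat) : (p < m.+1)%N -> (q < m.+1)%N ->
    (p %/ n = q %/ n)%N -> Gnk R k n m (permZ (transp p q))
| Gnk_comp f g : Gnk R k n m f -> Gnk R k n m g -> Gnk R k n m (f \o g).
Set Implicit Arguments.

Definition Gnk_invariant {R : realType} (k n m : nat)
    (Phi : 'M[R]_(2, m.+1) -> R) : Prop :=
  forall sigma, Gnk R k n m sigma ->
    forall Z : 'M[R]_(2, m.+1), Z != 0 -> Phi (sigma Z) = Phi Z.

(* Lebesgue integral over R^d of a nonnegative function, as an iterated
   integral (equal to the product-measure integral by Tonelli). *)
Fixpoint iter_int {R : realType} (d : nat) (F : (nat -> R) -> \bar R)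
  : \bar R :=
  match d with
  | 0 => F (fun _ => 0)
  | d'.+1 => (\int[@lebesgue_measure R]_t
               iter_int d' (fun x => F (fun i => if i == d' then t else x i)))%E
  end.

Definition mx_of_coords {R : realType} {m : nat} (x : nat -> R)
  : 'M[R]_(2, m) := \matrix_(r, c) x (2 * c + r)%N.

(* volume element of g = a * FS in the chart {z_0 = 1} (whose complement has
   measure zero): det(g_{l mu}) times Lebesgue measure on C^m = R^{2m}. *)
Definition vol_density {R : realType} {m : nat} (a : R) (w : 'M[R]_(2, m))
  : R := complex.Re (\det (cplx_hessian (fs_potential a) w)).

Definition integral_exp {R : realType} {m : nat} (a alpha : R)
    (Phi : 'M[R]_(2, m.+1) -> R) : \bar R :=
  iter_int (2 * m)%N (fun x =>
    let w : 'M[R]_(2, m) := mx_of_coords x in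
    (expR (- (alpha * Phi (chart ord0 w))) * vol_density a w)%:E).

(* Main.v *)
(* Put N = m + 1 = k n. Admissibility says that Psi = N ln |Z|^2 + Phi is
   plurisubharmonic, and Phi is invariant under the torus, so Psi is a convex function of
   the x_c = ln |z_c| and is nondecreasing in each |z_c|. G_{n,k} permutes the coordinates
   transitively and Phi is homogeneous of degree 0, so the partial derivatives of Phi
   vanish at (1,..,1), and in the chart z_0 = 1 the tangent inequality at x = 0 reads
     N ln (1 + |z|^2) + Phi(z) >= N ln N + Phi(1,..,1) + 2 sum_c ln |z_c|.
   Monotonicity on the unit polydisc gives Phi <= Phi(1,..,1) + N ln N, so sup Phi = 0
   forces Phi(1,..,1) >= - N ln N. Since dv has density N^m (1 + |z|^2)^{- N}, for
   0 <= alpha < 1 this yields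
     e^{- alpha Phi} dv <= N^m prod_c |z_c|^{- 2 alpha} (1 + |z|^2)^{- N (1 - alpha)},
   which is dominated by the product over the 2 m real coordinates of the integrable
   weights |t|^{- alpha} (1 + t^2)^{- gamma}, for any gamma with
   1 - alpha < 2 gamma <= (1 - alpha) N / m. For alpha < 0 use Phi <= 0. *)

Require Import Defs.
From mathcomp Require Import all_boot all_order all_algebra.
From mathcomp Require Import all_classical all_reals all_analysis.
From mathcomp.real_closed Require Import complex.
From mathcomp Require Import measurable_realfun ring lra zify.
Import Order.TTheory GRing.Theory Num.Theory.
Import numFieldNormedType.Exports.
Local Open Scope ring_scope.
Local Open Scope classical_set_scope.

Set Implicit Arguments.
Unset Strict Implicit.
Unset Printing Implicit Defensive.

(** * Differentiability on matrix spaces *)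

Lemma is_derive_lineP (R : realType) (V W : normedModType R) (f : V -> W)
    (y e : V) (t : R) (d : W) :
  is_derive t (1 : R) (fun s : R => f (y + s *: e)) d <-> is_derive (y + t *: e) e f d.
Proof.
have quotientE : (fun h : R => h^-1 *: (((fun s : R => f (y + s *: e)) \o shift t) (h *: 1)
      - f (y + t *: e))) =
    (fun h : R => h^-1 *: ((f \o shift (y + t *: e)) (h *: e) - f (y + t *: e))).
  by apply/funext => h /=; rewrite [h *: 1]mulr1 scalerDl addrCA.
by split=> -[df dE]; split; move: df dE; rewrite /derivable /derive quotientE.
Qed.

Lemma is_derive_line0P (R : realType) (V W : normedModType R) (f : V -> W) (y e : V) (d : W) :
  is_derive (0 : R) (1 : R) (fun s : R => f (y + s *: e)) d <-> is_derive y e f d.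
Proof. by rewrite is_derive_lineP scale0r addr0. Qed.

Lemma is_derive_comp_affine (R : realType) (U V W : normedModType R) (f : V -> W)
    (A : U -> V) (x v : U) (w : V) (d : W) :
  (forall h : R, A (x + h *: v) = A x + h *: w) ->
  is_derive x v (f \o A) d <-> is_derive (A x) w f d.
Proof.
move=> A_affine; rewrite -is_derive_line0P -[X in _ <-> X]is_derive_line0P.
by under eq_fun do rewrite /= A_affine.
Qed.

Lemma MVT_line (R : realType) (V : normedModType R) (f : V -> R) (y e : V) (a : R) :
  (forall t : R, `|t| <= `|a| -> derivable f (y + t *: e) e) ->
  exists2 c : R, `|c| <= `|a| & f (y + a *: e) - f y = a * 'D_e f (y + c *: e).
Proof.
move=> df; pose g (s : R) := f (y + (a * s) *: e).
have le_scale (s : R) : s \in `[0, 1]%R -> `|a * s| <= `|a|.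
  by rewrite in_itv/= => /andP[s0 s1]; rewrite normrM ler_piMr// ger0_norm.
have dg (s : R) : s \in `[0, 1]%R -> is_derive s (1 : R) g ('D_e f (y + (a * s) *: e) * a).
  move=> /le_scale/df/derivableP/is_derive_lineP dline.
  have da : is_derive s (1 : R) ( *%R a) (a * 1) by exact: is_deriveZ.
  by move: (is_derive1_comp dline da); rewrite mulr1.
have g_cont : {within `[0, 1], continuous g}.
  by apply: derivable_within_continuous => s /dg [].
have [c c01 mean_value] := MVT_segment ler01 (fun s s01 => dg s (subset_itv_oo_cc s01)) g_cont.
exists (a * c); first exact: le_scale.
by move: mean_value; rewrite /g mulr0 scale0r !addr0 !(mulr1, subr0) mulrC.
Qed.

Lemma near_neq0 (R : realType) (V : normedModType R) (x : V) :
  x != 0 -> \forall y \near x, y != 0.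
Proof. by move=> x0; apply: (@cvgr_neq0 R V V (nbhs x) _ id x _ x0); exact: cvg_id. Qed.

Lemma mx_entry_norm_le (R : realType) p q (h : 'M[R]_(p, q)) i j : `|h i j| <= `|h|.
Proof. by rewrite [leRHS]/Num.Def.normr/= mx_normrE; exact: (le_bigmax _ _ (i, j)). Qed.

Lemma mx_norm_le (R : realType) p q (h : 'M[R]_(p, q)) (e : R) :
  0 <= e -> (forall i j, `|h i j| <= e) -> `|h| <= e.
Proof.
move=> e0 entries_le; rewrite [leLHS]/Num.Def.normr/= mx_normrE.
by apply: bigmax_le => //= -[i j] _; exact: entries_le.
Qed.

(* Walk from [x] to [x + h] changing one entry at a time. *)
Lemma mx_mean_value_le (R : realType) p q (f : 'M[R]_(p, q) -> R)
    (x h : 'M[R]_(p, q)) (e : R) :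
  (forall y, `|y - x| <= `|h| -> forall i j,
     derivable f y (delta_mx i j) /\ `|'D_(delta_mx i j) f y| <= e) ->
  `|f (x + h) - f x| <= (p * q)%:R * e * `|h|.
Proof.
move=> partials_le; pose walk (s : seq ('I_p * 'I_q)) : 'M[R]_(p, q) :=
  \matrix_(i, j) if (i, j) \in s then h i j else 0.
have walkS c s : c \notin s -> walk (c :: s) = walk s + h c.1 c.2 *: delta_mx c.1 c.2.
  case: c => i j cs; apply/matrixP => i' j'; rewrite !mxE in_cons xpair_eqE.
  by case: eqP => [->|_]/=; [case: eqP => [->|_]/=|];
    rewrite ?(negbTE cs) ?mulr1 ?mulr0 ?add0r ?addr0.
have walk_near c s t : c \notin s -> `|t| <= `|h c.1 c.2| ->
    `|x + walk s + t *: delta_mx c.1 c.2 - x| <= `|h|.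
  case: c => i j cs th; rewrite -[x + _ + _]addrA addrAC subrr add0r.
  apply: mx_norm_le => // i' j'.
  rewrite !mxE; have [/andP[/eqP-> /eqP->]|_]/= := boolP ((i' == i) && (j' == j)).
    by rewrite (negbTE cs) add0r mulr1 (le_trans th)// mx_entry_norm_le.
  by rewrite mulr0 addr0; case: ifP => _; rewrite ?mx_entry_norm_le// normr0.
have walk_le s : uniq s -> `|f (x + walk s) - f x| <= (size s)%:R * (e * `|h|).
  elim: s => [_|c s IH /= /andP[cs us]].
    have -> : walk [::] = 0 by apply/matrixP => i j; rewrite !mxE.
    by rewrite addr0 subrr normr0 mul0r.
  rewrite walkS// addrA -(subrKA (f (x + walk s))) (le_trans (ler_normD _ _))//.
  rewrite -nat1r mulrDl mul1r lerD ?IH//.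
  have [t th|t th ->] := @MVT_line R _ f (x + walk s) (delta_mx c.1 c.2) (h c.1 c.2).
    by have [] := partials_le _ (walk_near _ _ _ cs th) c.1 c.2.
  have [_ De] := partials_le _ (walk_near _ _ _ cs th) c.1 c.2.
  by rewrite normrM mulrC ler_pM// mx_entry_norm_le.
have := walk_le _ (enum_uniq {: 'I_p * 'I_q}); rewrite -cardE card_prod !card_ord mulrA.
by rewrite (_ : walk _ = h)//; apply/matrixP => i j; rewrite mxE mem_enum.
Qed.

Lemma differentiable_of_littleo (R : realType) (V W : normedModType R) (f : V -> W) (x : V) :
  (forall e : R, 0 < e -> \forall h \near (0 : V), `|f (x + h) - f x| <= e * `|h|) ->
  differentiable f x.
Proof.
move=> increment_small.
have zero_cont : continuous (\0 : {linear V -> W}) by move=> y; exact: cst_continuous.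
have fE : f \o shift x = cst (f x) + (\0 : {linear V -> W}) +o_ 0 id.
  apply/eqaddoP => e /increment_small; apply: filterS => h /=.
  by rewrite !fctE /= opprD addrA subr0 [h + x]addrC.
by apply/diff_locallyP; rewrite (diff_unique zero_cont fE).
Qed.

Lemma is_derive_sum2 (R : realType) (V : normedModType R) p q
    (F : 'I_p -> 'I_q -> V -> R) (dF : 'I_p -> 'I_q -> R) (x v : V) :
  (forall i j, is_derive x v (F i j) (dF i j)) ->
  is_derive x v (fun y => \sum_i \sum_j F i j y) (\sum_i \sum_j dF i j).
Proof.
move=> dFij; rewrite (_ : (fun y => _) = \sum_i \sum_j F i j).
  by apply: is_derive_sum => i; exact: is_derive_sum.
by apply/funext => y; rewrite fct_sumE; apply: eq_bigr => i _; rewrite fct_sumE.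
Qed.

Lemma is_derive_mxP (R : realType) (V : normedModType R) p q (M : V -> 'M[R]_(p, q))
    (dM : 'M[R]_(p, q)) (x v : V) :
  is_derive x v M dM <-> forall i j, is_derive x v (fun y => M y i j) (dM i j).
Proof.
split=> [[Mx <-] i j|Mij].
  by rewrite derive_mx// mxE; apply: derivableP; move/derivable_mxP : Mx; exact.
have Mx : derivable M x v by apply/derivable_mxP => i j; case: (Mij i j).
by split=> //; rewrite derive_mx//; apply/matrixP => i j; rewrite mxE; case: (Mij i j).
Qed.

Lemma is_derive_mx_linear (R : realType) p q (a : 'I_p -> 'I_q -> R) (x v : 'M[R]_(p, q)) :
  is_derive x v (fun y : 'M[R]_(p, q) => \sum_i \sum_j a i j * y i j)
    (\sum_i \sum_j a i j * v i j).
Proof.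
apply: is_derive_sum2 => i j; apply: is_deriveZ.
by move: i j; apply/is_derive_mxP; exact: is_derive_id.
Qed.

Lemma differentiable_mx_linear (R : realType) p q (a : 'I_p -> 'I_q -> R) (x : 'M[R]_(p, q)) :
  differentiable (fun y : 'M[R]_(p, q) => \sum_i \sum_j a i j * y i j) x.
Proof.
rewrite (_ : (fun y => _) = \sum_i \sum_j (fun y : 'M[R]_(p, q) => a i j * y i j)); last first.
  by apply/funext => y; rewrite fct_sumE; apply: eq_bigr => i _; rewrite fct_sumE.
apply: differentiable_sum => i; apply: differentiable_sum => j.
by apply: differentiableZ; exact: differentiable_coord.
Qed.

Lemma sum_mul_delta_mx (R : pzSemiRingType) p q (a : 'I_p -> 'I_q -> R) (i : 'I_p) (j : 'I_q) :
  \sum_i' \sum_j' a i' j' * (delta_mx i j : 'M[R]_(p, q)) i' j' = a i j.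
Proof.
rewrite (bigD1 i)//= (bigD1 j)//= mxE !eqxx mulr1.
rewrite !big1 ?addr0// => [i' /negbTE i'i|j' /negbTE j'j].
  by rewrite big1// => j' _; rewrite mxE i'i mulr0.
by rewrite mxE j'j andbF mulr0.
Qed.

(* Subtracting the candidate differential [L] reduces to the case where all the
   partial derivatives vanish at [x]. *)
Lemma differentiable_of_partials (R : realType) p q (f : 'M[R]_(p, q) -> R) (x : 'M[R]_(p, q)) :
  (\forall y \near x, forall i j, derivable f y (delta_mx i j)) ->
  (forall i j, {for x, continuous ('D_(delta_mx i j) f)}) ->
  differentiable f x.
Proof.
move=> df cf; pose a i j := 'D_(delta_mx i j) f x.
pose L (y : 'M[R]_(p, q)) := \sum_i \sum_j a i j * y i j.
have L_diff y : differentiable L y by exact: differentiable_mx_linear.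
have DL i j y : 'D_(delta_mx i j) L y = a i j.
  by have [_ ->] := is_derive_mx_linear a y (delta_mx i j); rewrite sum_mul_delta_mx.
rewrite -[f](subrK L); apply: differentiableD => //.
apply: differentiable_of_littleo => e e0; pose e' := e / (p * q).+1%:R.
have e'0 : 0 < e' by rewrite divr_gt0.
have small_partials : \forall y \near x, forall i j, derivable (f - L) y (delta_mx i j) /\
    `|'D_(delta_mx i j) (f - L) y| <= e'.
  near=> y; move=> i j.
  have dfy : derivable f y (delta_mx i j) by move: i j; near: y.
  have dLy : derivable L y (delta_mx i j) by exact: diff_derivable.
  split; first exact: derivableB.
  rewrite deriveB// DL distrC.
  move: i j {dfy dLy}; near: y; apply: filter_forall => i; apply: filter_forall => j.
  by have /cvgrPdist_le := cf i j; apply.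
have /nbhs_ballP[d /= d0 ball_small] := small_partials.
near=> h.
have h_lt : `|h| < d by near: h; exact: (@nbhs0_lt R 'M[R]_(p, q) d d0).
apply: le_trans (mx_mean_value_le (e := e') _) _ => [y yx|].
  by apply: ball_small; rewrite -ball_normE /ball_/= distrC (le_lt_trans yx).
rewrite ler_wpM2r// /e' mulrCA -[leRHS]mulr1 ler_wpM2l ?(ltW e0)//.
by rewrite ler_pdivrMr// mul1r ler_nat.
Unshelve. all: by end_near. Qed.

Lemma derive_dirZ (R : realType) (V W : normedModType R) (f : V -> W) (t : R) (x v : V) :
  differentiable f x -> 'D_(t *: v) f x = t *: 'D_v f x.
Proof. by move=> df; rewrite !deriveE// linearZ. Qed.

Lemma derive_partials (R : realType) p q (f : 'M[R]_(p, q) -> R) (x v : 'M[R]_(p, q)) :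
  differentiable f x ->
  'D_v f x = \sum_i \sum_j v i j * 'D_(delta_mx i j) f x.
Proof.
move=> df; rewrite deriveE// [v in LHS]matrix_sum_delta linear_sum.
apply: eq_bigr => i _; rewrite linear_sum; apply: eq_bigr => j _.
by rewrite linearZ deriveE.
Qed.

Lemma is_derive_comp_curve (R : realType) (V W : normedModType R) (f : V -> W)
    (g : R -> V) (t : R) (dg : V) :
  differentiable f (g t) -> is_derive t (1 : R) g dg ->
  is_derive t (1 : R) (f \o g) ('D_dg f (g t)).
Proof.
move=> df [gd gE]; have gdf : differentiable g t by exact/derivable1_diffP.
have cd := differentiable_comp gdf df.
split; first exact/derivable1_diffP.
by rewrite deriveE// diff_comp//= -(deriveE _ gdf) gE deriveE.
Qed.

Definition twice_differentiable (R : realType) p q (f : 'M[R]_(p, q) -> R) :=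
  (forall w, differentiable f w) /\ (forall v w, differentiable ('D_v f) w).

Lemma derive2_partials (R : realType) p q (f : 'M[R]_(p, q) -> R) (x u v : 'M[R]_(p, q)) :
  twice_differentiable f ->
  'D_u ('D_v f) x = \sum_i \sum_j v i j * 'D_u ('D_(delta_mx i j) f) x.
Proof.
move=> [df d2f]; have -> : 'D_v f = fun y => \sum_i \sum_j v i j * 'D_(delta_mx i j) f y.
  by apply/funext => y; exact: derive_partials.
suff [] : is_derive x u (fun y => \sum_i \sum_j v i j * 'D_(delta_mx i j) f y)
    (\sum_i \sum_j v i j * 'D_u ('D_(delta_mx i j) f) x) by [].
apply: is_derive_sum2 => i j; apply: is_deriveZ; apply: derivableP.
exact: diff_derivable.
Qed.

Lemma is_derive_along_field (R : realType) p q (f : 'M[R]_(p, q) -> R)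
    (g u : R -> 'M[R]_(p, q)) (t : R) (dg du : 'M[R]_(p, q)) :
  twice_differentiable f -> is_derive t (1 : R) g dg -> is_derive t (1 : R) u du ->
  is_derive t (1 : R) (fun s => 'D_(u s) f (g s))
    ('D_dg ('D_(u t) f) (g t) + 'D_du f (g t)).
Proof.
move=> f_diff2 g_deriv u_deriv; have [df d2f] := f_diff2.
rewrite (_ : (fun s => _) =
    fun s => \sum_i \sum_j u s i j * 'D_(delta_mx i j) f (g s)); last first.
  by apply/funext => s; exact: derive_partials.
rewrite derive2_partials// [X in _ + X]derive_partials// -big_split/=.
under eq_bigr do rewrite -big_split/=.
apply: is_derive_sum2 => i j; have /is_derive_mxP/(_ i j) uij_deriv := u_deriv.
have := is_deriveM uij_deriv (is_derive_comp_curve (d2f (delta_mx i j) _) g_deriv).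
by move/is_derive_eq; apply; rewrite /GRing.scale/= [X in _ + X = _]mulrC.
Qed.

Lemma is_derive_ge0_le (R : realType) (F dF : R -> R) (a b : R) : a <= b ->
  (forall t, a <= t <= b -> is_derive t (1 : R) F (dF t)) ->
  (forall t, a < t < b -> 0 <= dF t) -> F a <= F b.
Proof.
move=> ab F_deriv dF_ge0; apply: (@ger0_derive1_ndecr _ F a b) => // [t|t|].
- by rewrite in_itv/= => /andP[/ltW ta /ltW tb]; case: (F_deriv t) => //; rewrite ta.
- rewrite in_itv/= => tab; rewrite derive1E; case: (F_deriv t) => [|_ ->]; last exact: dF_ge0.
  by case/andP: tab => /ltW -> /ltW ->.
- by apply: derivable_within_continuous => t; rewrite in_itv/= => /F_deriv [].
Qed.

Lemma tangent_le (R : realType) (F dF d2F : R -> R) (a b : R) : a <= b ->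
  (forall t, is_derive t (1 : R) F (dF t)) -> (forall t, is_derive t (1 : R) dF (d2F t)) ->
  (forall t, 0 <= d2F t) -> F a + dF a * (b - a) <= F b.
Proof.
move=> ab F_deriv dF_deriv d2F_ge0.
have F_cont : {within `[a, b], continuous F}.
  by apply: derivable_within_continuous => t _; case: (F_deriv t).
have [c /[!in_itv]/= /andP[ac cb] FE] := MVT_segment ab (fun t _ => F_deriv t) F_cont.
rewrite -lerBrDl FE ler_wpM2r ?subr_ge0//.
exact: is_derive_ge0_le ac (fun t _ => dF_deriv t) (fun t _ => d2F_ge0 t).
Qed.

(** * Torus-invariant plurisubharmonic functions *)

Lemma sum_ord2 (V : nmodType) (F : 'I_2 -> V) : \sum_i F i = F re_ix + F im_ix.
Proof. by rewrite big_ord_recl big_ord1; congr (F _ + F _); apply/val_inj. Qed.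

Lemma ord2_cases (i : 'I_2) : i = re_ix \/ i = im_ix.
Proof. by case: i => [[|[|//]] ?]; [left|right]; apply/val_inj. Qed.

Definition cplx_mx (R : realType) m (x y : 'I_m -> R) : 'M[R]_(2, m) :=
  \matrix_(i, c) if i == re_ix then x c else y c.

Definition real_mx (R : realType) m (x : 'I_m -> R) := cplx_mx x (fun=> 0).

Definition polar_mx (R : realType) m (r th : 'I_m -> R) :=
  cplx_mx (fun c => r c * cos (th c)) (fun c => r c * sin (th c)).

Lemma cplx_mx_rows (R : realType) m (w : 'M[R]_(2, m)) : cplx_mx (w re_ix) (w im_ix) = w.
Proof. by apply/matrixP => i c; rewrite mxE; case: (ord2_cases i) => ->. Qed.

Lemma polar_mx0 (R : realType) m (r : 'I_m -> R) : polar_mx r (fun=> 0) = real_mx r.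
Proof.
by congr cplx_mx; apply/funext => c; rewrite ?cos0 ?sin0 ?mulr1 ?mulr0.
Qed.

Definition mul_i (R : realType) m (v : 'M[R]_(2, m)) : 'M[R]_(2, m) := Defs.cscale 0 1 v.

Lemma mul_i_cplx_mx (R : realType) m (x y : 'I_m -> R) :
  mul_i (cplx_mx x y) = cplx_mx (fun c => - y c) x.
Proof. by apply/matrixP => i c; rewrite !mxE/= !mul0r !mul1r sub0r add0r. Qed.

Lemma mul_i_real_mx (R : realType) m (x : 'I_m -> R) :
  mul_i (real_mx x) = cplx_mx (fun=> 0) x.
Proof. by rewrite mul_i_cplx_mx; congr cplx_mx; apply/funext => c; rewrite oppr0. Qed.

Lemma is_derive_cplx_mx (R : realType) m (x y : R -> 'I_m -> R) (dx dy : 'I_m -> R) (t : R) :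
  (forall c, is_derive t (1 : R) (x ^~ c) (dx c)) ->
  (forall c, is_derive t (1 : R) (y ^~ c) (dy c)) ->
  is_derive t (1 : R) (fun s => cplx_mx (x s) (y s)) (cplx_mx dx dy).
Proof.
move=> x_deriv y_deriv; apply/is_derive_mxP => i c; rewrite mxE; under eq_fun do rewrite mxE.
by case: ifP.
Qed.

Lemma is_derive_real_mx (R : realType) m (x : R -> 'I_m -> R) (dx : 'I_m -> R) (t : R) :
  (forall c, is_derive t (1 : R) (x ^~ c) (dx c)) ->
  is_derive t (1 : R) (fun s => real_mx (x s)) (real_mx dx).
Proof. by move=> x_deriv; apply: is_derive_cplx_mx => // c; exact: is_derive_cst. Qed.

Definition with_coord (R : realType) m (r : 'I_m -> R) (l : 'I_m) (t : R) :=
  real_mx [eta r with l |-> t].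

Lemma is_derive_with_coord (R : realType) m (r : 'I_m -> R) (l : 'I_m) (t : R) :
  is_derive t (1 : R) (with_coord r l) (ex l).
Proof.
apply/is_derive_mxP => i c; rewrite mxE; under eq_fun do rewrite mxE /=.
case: (i == re_ix) => /=; last exact: is_derive_cst.
by case: (c == l); [exact: is_derive_id|exact: is_derive_cst].
Qed.

Lemma derive_ex_ey (R : realType) m (f : 'M[R]_(2, m) -> R) x v :
  differentiable f x ->
  'D_v f x = \sum_l (v re_ix l * 'D_(ex l) f x + v im_ix l * 'D_(ey l) f x).
Proof.
move=> df; rewrite derive_partials// exchange_big/=.
by under eq_bigr do rewrite sum_ord2.
Qed.

Definition levi_form (R : realType) m (f : 'M[R]_(2, m) -> R) (w v : 'M[R]_(2, m)) : R :=
  'D_v ('D_v f) w + 'D_(mul_i v) ('D_(mul_i v) f) w.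

Definition plurisubharmonic (R : realType) m (f : 'M[R]_(2, m) -> R) :=
  forall w v, 0 <= levi_form f w v.

Definition torus_invariant (R : realType) m (f : 'M[R]_(2, m) -> R) :=
  forall r th, f (polar_mx r th) = f (real_mx r).

Definition torus_psh (R : realType) m (f : 'M[R]_(2, m) -> R) :=
  [/\ twice_differentiable f, torus_invariant f & plurisubharmonic f].

Section TorusPsh.
Variables (R : realType) (m : nat) (f : 'M[R]_(2, m) -> R).
Hypothesis f_torus_psh : torus_psh f.

Let f_diff2 : twice_differentiable f. Proof. by case: f_torus_psh. Qed.
Let f_diff w : differentiable f w. Proof. by case: f_diff2. Qed.
Let Df_diff v w : differentiable ('D_v f) w. Proof. by case: f_diff2. Qed.
Let f_torus : torus_invariant f. Proof. by case: f_torus_psh. Qed.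
Let f_psh : plurisubharmonic f. Proof. by case: f_torus_psh. Qed.

(* [f] is constant along the circle [s |-> (r_c e^{i v_c s})_c]; this is its second
   derivative at [s = 0]. *)
Lemma circle_second_derivative (r v : 'I_m -> R) :
  'D_(mul_i (real_mx (fun c => v c * r c)))
    ('D_(mul_i (real_mx (fun c => v c * r c))) f) (real_mx r) =
  'D_(real_mx (fun c => v c ^+ 2 * r c)) f (real_mx r).
Proof.
have dcos s c : is_derive s (1 : R) (fun s => cos (v c * s)) (- v c * sin (v c * s)).
  by apply: is_derive_eq; rewrite /GRing.scale/=; ring.
have dsin s c : is_derive s (1 : R) (fun s => sin (v c * s)) (v c * cos (v c * s)).
  by apply: is_derive_eq; rewrite /GRing.scale/=; ring.
pose g s := polar_mx r (fun c => v c * s).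
pose u s := cplx_mx (fun c => r c * (- v c * sin (v c * s)))
                    (fun c => r c * (v c * cos (v c * s))).
have g_deriv s : is_derive s (1 : R) g (u s).
  by apply: is_derive_cplx_mx => c; apply: is_deriveZ.
pose w s := cplx_mx (fun c => v c ^+ 2 * (r c * cos (v c * s)))
                    (fun c => v c ^+ 2 * (r c * sin (v c * s))).
have u_deriv s : is_derive s (1 : R) u (- 1 *: w s).
  rewrite (_ : _ *: _ = cplx_mx (fun c => r c * (- v c * (v c * cos (v c * s))))
                                (fun c => r c * (v c * (- v c * sin (v c * s))))); last first.
    by apply/matrixP => i c; rewrite !mxE; case: ifP => _; ring.
  by apply: is_derive_cplx_mx => c; apply: is_deriveZ; apply: is_deriveZ.
have Du0 : (fun s => 'D_(u s) f (g s)) = cst 0.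
  apply/funext => s; have [_ <-] := is_derive_comp_curve (f_diff (g s)) (g_deriv s).
  rewrite (_ : f \o g = cst (f (real_mx r))) ?derive_cst//.
  by apply/funext => s'; rewrite /= /g f_torus.
have g0 : g 0 = real_mx r by rewrite -polar_mx0; congr polar_mx; apply/funext => c; rewrite mulr0.
have u0 : u 0 = mul_i (real_mx (fun c => v c * r c)).
  by rewrite mul_i_real_mx; congr cplx_mx; apply/funext => c; rewrite mulr0 ?sin0 ?cos0; ring.
have w0 : w 0 = real_mx (fun c => v c ^+ 2 * r c).
  by congr cplx_mx; apply/funext => c; rewrite mulr0 ?sin0 ?cos0 ?mulr1 ?mulr0.
have [_] := is_derive_along_field f_diff2 (g_deriv 0) (u_deriv 0).
rewrite Du0 derive_cst g0 u0 w0 derive_dirZ// scaleN1r => /esym/eqP.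
by rewrite subr_eq0 => /eqP.
Qed.

Lemma log_second_derivative (r v : 'I_m -> R) (t : R) :
  let g s := real_mx (fun c => r c * expR (v c * s)) in
  let dg s := real_mx (fun c => v c * (r c * expR (v c * s))) in
  is_derive t (1 : R) (f \o g) ('D_(dg t) f (g t)) /\
  is_derive t (1 : R) (fun s => 'D_(dg s) f (g s)) (levi_form f (g t) (dg t)).
Proof.
have dexp s c : is_derive s (1 : R) (fun s => r c * expR (v c * s))
    (v c * (r c * expR (v c * s))).
  by apply: is_derive_eq; rewrite /GRing.scale/=; ring.
move=> g dg; have g_deriv s : is_derive s (1 : R) g (dg s) by exact: is_derive_real_mx.
have dg_deriv : is_derive t (1 : R) dg (real_mx (fun c => v c ^+ 2 * (r c * expR (v c * t)))).
  apply: is_derive_real_mx => c; rewrite expr2 -mulrA; exact: is_deriveZ.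
split; first exact: is_derive_comp_curve.
rewrite /levi_form (circle_second_derivative (fun c => r c * expR (v c * t)) v).
exact: is_derive_along_field.
Qed.

Lemma torus_psh_log_tangent_le (r v : 'I_m -> R) :
  f (real_mx r) + 'D_(real_mx (fun c => v c * r c)) f (real_mx r) <=
  f (real_mx (fun c => r c * expR (v c))).
Proof.
have F_deriv t := (log_second_derivative r v t).1.
have dF_deriv t := (log_second_derivative r v t).2.
have := tangent_le ler01 F_deriv dF_deriv (fun t => f_psh _ _); rewrite subr0 mulr1 /=.
under eq_fun do rewrite mulr0 expR0 mulr1.
under [X in _ + 'D_(real_mx X) _ _]eq_fun do rewrite mulr0 expR0 mulr1.
by under [X in _ <= f (real_mx X)]eq_fun do rewrite mulr1.
Qed.

Lemma levi_form_radial r l t :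
  levi_form f (with_coord r l t) (t *: ex l) =
  t * ('D_(ex l) ('D_(t *: ex l) f) (with_coord r l t) + 'D_(ex l) f (with_coord r l t)).
Proof.
have tex k : real_mx (fun c => (c == l)%:R ^+ k.+1 * [eta r with l |-> t] c) = t *: ex l.
  apply/matrixP => i c; rewrite !mxE; case: (i == re_ix); rewrite ?mulr0//=.
  by case: (c == l); rewrite ?expr1n ?expr0n ?mul1r ?mulr1 ?mul0r ?mulr0.
have := circle_second_derivative [eta r with l |-> t] (fun c => (c == l)%:R).
rewrite (tex 0) (tex 1) /levi_form => ->.
by rewrite !derive_dirZ// mulrDr.
Qed.

(* [t * 'D_(ex l) f] vanishes at [t = 0] and is nondecreasing, because its derivative
   is the Levi form up to a positive factor. *)
Lemma radial_derivative_ge0 (r : 'I_m -> R) (l : 'I_m) (t : R) : 0 < t ->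
  0 <= 'D_(ex l) f (with_coord r l t).
Proof.
move=> t0; pose g := with_coord r l.
have tex_deriv s : is_derive s (1 : R) (fun s => s *: ex l : 'M[R]_(2, m)) (ex l).
  apply/is_derive_mxP => i c; under eq_fun do rewrite mxE.
  by apply: is_derive_eq; rewrite /GRing.scale/= mulr0 add0r mulr1.
rewrite -(pmulr_rge0 _ t0).
have -> : t * 'D_(ex l) f (g t) = 'D_(t *: ex l) f (g t) by rewrite derive_dirZ.
have <- : 'D_(0 *: ex l) f (g 0) = 0 by rewrite derive_dirZ// scale0r.
have F_deriv s := is_derive_along_field f_diff2 (is_derive_with_coord r l s) (tex_deriv s).
apply: is_derive_ge0_le (ltW t0) (fun s _ => F_deriv s) _ => s /andP[s0 _].
by rewrite -(pmulr_rge0 _ s0) -levi_form_radial.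
Qed.

Lemma with_coord_le (r : 'I_m -> R) (l : 'I_m) (s t : R) : 0 <= s -> s <= t ->
  f (with_coord r l s) <= f (with_coord r l t).
Proof.
move=> s0 st; have F_deriv a := is_derive_comp_curve (f_diff _) (is_derive_with_coord r l a).
apply: is_derive_ge0_le st (fun a _ => F_deriv a) _ => a /andP[sa _].
by apply: radial_derivative_ge0; exact: le_lt_trans sa.
Qed.

Lemma torus_psh_real_mx_le (r r' : 'I_m -> R) : (forall c, 0 <= r c <= r' c) ->
  f (real_mx r) <= f (real_mx r').
Proof.
move=> rr'; pose mixed (s : seq 'I_m) c := if c \in s then r' c else r c.
have mixed_le s : f (real_mx r) <= f (real_mx (mixed s)).
  elim: s => // l s /le_trans; apply.
  have -> : real_mx (mixed s) = with_coord (mixed s) l (mixed s l).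
    by congr real_mx; apply/funext => c /=; case: eqP => [->|].
  have -> : real_mx (mixed (l :: s)) = with_coord (mixed s) l (r' l).
    by congr real_mx; apply/funext => c /=; rewrite /mixed in_cons; case: eqP => [->|].
  have /andP[rl0 rl] := rr' l.
  by apply: with_coord_le; rewrite /mixed; case: ifP => // _; exact: le_trans rl.
rewrite (_ : r' = mixed (enum 'I_m)); first exact: mixed_le.
by apply/funext => c; rewrite /mixed mem_enum.
Qed.

End TorusPsh.

(** * The Fubini-Study potential *)

Lemma Re_hermitian_term (R : realType) (a b x y x' y' : R) :
  complex.Re (Complex a b * Complex x y * (Complex x' y')^* : R[i]) =
  a * (x * x' + y * y') + b * (x * y' - y * x').
Proof. by rewrite /=; ring. Qed.

Lemma levi_form_cplx_hessian (R : realType) m (f : 'M[R]_(2, m) -> R) (w v : 'M[R]_(2, m)) :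
  twice_differentiable f ->
  let xi l : R[i] := Complex (v re_ix l) (v im_ix l) in
  levi_form f w v =
  4 * complex.Re (\sum_l \sum_mu cplx_hessian f w l mu * xi l * (xi mu)^*).
Proof.
move=> f_diff2 xi; have [_ d2f] := f_diff2.
pose xx l mu := 'D_(ex l) ('D_(ex mu) f) w; pose xy l mu := 'D_(ex l) ('D_(ey mu) f) w.
pose yx l mu := 'D_(ey l) ('D_(ex mu) f) w; pose yy l mu := 'D_(ey l) ('D_(ey mu) f) w.
have DxE u l : 'D_(ex l) ('D_u f) w = \sum_mu (u re_ix mu * xx l mu + u im_ix mu * xy l mu).
  by rewrite derive2_partials// exchange_big/=; under eq_bigr do rewrite sum_ord2.
have DyE u l : 'D_(ey l) ('D_u f) w = \sum_mu (u re_ix mu * yx l mu + u im_ix mu * yy l mu).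
  by rewrite derive2_partials// exchange_big/=; under eq_bigr do rewrite sum_ord2.
have D2E u : 'D_u ('D_u f) w = \sum_l
    (u re_ix l * (\sum_mu (u re_ix mu * xx l mu + u im_ix mu * xy l mu))
   + u im_ix l * (\sum_mu (u re_ix mu * yx l mu + u im_ix mu * yy l mu))).
  by rewrite (@derive_ex_ey _ _ ('D_u f))//; apply: eq_bigr => l _; rewrite DxE DyE.
have hessianE l mu : cplx_hessian f w l mu =
    Complex ((xx l mu + yy l mu) / 4) ((xy l mu - yx l mu) / 4) by rewrite mxE.
rewrite /levi_form (D2E v) (D2E (mul_i v)).
under [in RHS]eq_bigr => l _ do under eq_bigr => mu _ do rewrite hessianE.
clear DxE DyE D2E hessianE d2f f_diff2; clearbody xx xy yx yy.
rewrite -big_split/= raddf_sum mulr_sumr; apply: eq_bigr => l _.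
rewrite !mulr_sumr -!big_split/= raddf_sum mulr_sumr; apply: eq_bigr => mu _.
by rewrite [X in _ = _ * X]Re_hermitian_term !mxE/=; field.
Qed.

Definition mxdot (R : realType) m (w v : 'M[R]_(2, m)) : R :=
  \sum_(r < 2) \sum_(c < m) w r c * v r c.

Lemma mxdotC (R : realType) m (w v : 'M[R]_(2, m)) : mxdot w v = mxdot v w.
Proof. by apply: eq_bigr => i _; apply: eq_bigr => j _; rewrite mulrC. Qed.

Lemma mxdotDl (R : realType) m (w u v : 'M[R]_(2, m)) (t : R) :
  mxdot (w + t *: u) v = mxdot w v + t * mxdot u v.
Proof.
rewrite /mxdot mulr_sumr -big_split; apply: eq_bigr => i _.
rewrite mulr_sumr -big_split; apply: eq_bigr => j _ /=.
by rewrite !mxE; ring.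
Qed.

Lemma mxdotDr (R : realType) m (w u v : 'M[R]_(2, m)) (t : R) :
  mxdot w (u + t *: v) = mxdot w u + t * mxdot w v.
Proof. by rewrite mxdotC mxdotDl ![mxdot _ w]mxdotC. Qed.

Lemma mxdot_delta (R : realType) m (w : 'M[R]_(2, m)) i l : mxdot w (delta_mx i l) = w i l.
Proof. exact: sum_mul_delta_mx. Qed.

Lemma sqnorm_mxdot (R : realType) m (w : 'M[R]_(2, m)) : sqnorm w = mxdot w w.
Proof. by []. Qed.

Lemma sqnorm_line (R : realType) m (w v : 'M[R]_(2, m)) (t : R) :
  sqnorm (w + t *: v) = sqnorm w + 2 * mxdot w v * t + sqnorm v * t ^+ 2.
Proof. by rewrite !sqnorm_mxdot mxdotDl !mxdotDr [mxdot v w]mxdotC; ring. Qed.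

Lemma sqnorm_ge0 (R : realType) m (w : 'M[R]_(2, m)) : 0 <= sqnorm w.
Proof. by apply: sumr_ge0 => i _; apply: sumr_ge0 => j _; exact: sqr_ge0. Qed.

Lemma sqnorm1_gt0 (R : realType) m (w : 'M[R]_(2, m)) : 0 < 1 + sqnorm w.
Proof. by rewrite ltr_pwDl// sqnorm_ge0. Qed.

Lemma is_derive_mxdotr (R : realType) m (v w u : 'M[R]_(2, m)) :
  is_derive w u (mxdot v) (mxdot v u).
Proof. exact: is_derive_mx_linear. Qed.

Lemma differentiable_mxdot (R : realType) m (v w : 'M[R]_(2, m)) :
  differentiable (mxdot v) w.
Proof. exact: differentiable_mx_linear. Qed.

Lemma differentiable_sqnorm1 (R : realType) m (w : 'M[R]_(2, m)) :
  differentiable (fun z : 'M[R]_(2, m) => 1 + sqnorm z) w.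
Proof.
rewrite (_ : (fun z => _) =
    cst 1 + \sum_i \sum_j (fun z : 'M[R]_(2, m) => z i j * z i j)); last first.
  apply/funext => z; rewrite fctE/= fct_sumE; congr (_ + _); apply: eq_bigr => i _.
  by rewrite fct_sumE.
apply: differentiableD; first exact: differentiable_cst.
apply: differentiable_sum => i; apply: differentiable_sum => j.
by apply: differentiableM; exact: differentiable_coord.
Qed.

Lemma is_derive_sqnorm_line (R : realType) m (w v : 'M[R]_(2, m)) :
  is_derive (0 : R) (1 : R) (fun t => 1 + sqnorm (w + t *: v)) (2 * mxdot w v).
Proof.
under eq_fun do rewrite sqnorm_line.
by apply: is_derive_eq; rewrite /GRing.scale/=; ring.
Qed.

Lemma differentiable_fs_potential (R : realType) m (a : R) (w : 'M[R]_(2, m)) :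
  differentiable (fs_potential a) w.
Proof.
apply: differentiableZ; apply: (differentiable_comp (differentiable_sqnorm1 w)).
by apply/derivable1_diffP; case: (is_derive1_ln (sqnorm1_gt0 w)).
Qed.

Lemma derive_fs_potential (R : realType) m (a : R) (w v : 'M[R]_(2, m)) :
  'D_v (fs_potential a) w = 2 * a * mxdot v w / (1 + sqnorm w).
Proof.
pose S (t : R) := 1 + sqnorm (w + t *: v).
have S0 : 0 < S 0 by exact: sqnorm1_gt0.
have dS : is_derive (0 : R) (1 : R) S (2 * mxdot w v) := is_derive_sqnorm_line w v.
have := is_deriveZ a (is_derive1_comp (is_derive1_ln S0) dS).
move/(@is_derive_line0P _ _ _ (fs_potential a)) => [_ ->].
by rewrite /S scale0r addr0 mxdotC /GRing.scale/=; ring.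
Qed.

Lemma twice_differentiable_fs_potential (R : realType) m (a : R) :
  twice_differentiable (fs_potential a : 'M[R]_(2, m) -> R).
Proof.
split=> [|v] w; first exact: differentiable_fs_potential.
rewrite (_ : 'D_v _ = (fun z => 2 * a * mxdot v z) * (fun z => (1 + sqnorm z)^-1)).
  apply: differentiableM; first by apply: differentiableZ; exact: differentiable_mxdot.
  by apply: differentiableV; [exact: differentiable_sqnorm1|rewrite gt_eqF ?sqnorm1_gt0].
by apply/funext => z; rewrite derive_fs_potential.
Qed.

Lemma derive2_fs_potential (R : realType) m (a : R) (w u v : 'M[R]_(2, m)) :
  'D_u ('D_v (fs_potential a)) w =
  2 * a * (mxdot u v / (1 + sqnorm w)
           - 2 * mxdot w u * mxdot w v / (1 + sqnorm w) ^+ 2).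
Proof.
pose S (t : R) := 1 + sqnorm (w + t *: u).
have S0 : S 0 != 0 by rewrite gt_eqF ?sqnorm1_gt0.
have dS : is_derive (0 : R) (1 : R) S (2 * mxdot w u) := is_derive_sqnorm_line w u.
have w1_neq0 : 1 + sqnorm w != 0 by rewrite gt_eqF ?sqnorm1_gt0.
have DE : 'D_v (fs_potential a) = fun z => 2 * a * mxdot v z / (1 + sqnorm z).
  by apply/funext => z; rewrite derive_fs_potential.
have dot_deriv : is_derive (0 : R) (1 : R) (fun t : R => mxdot v (w + t *: u)) (mxdot v u).
  by apply/is_derive_line0P; exact: is_derive_mxdotr.
have := is_deriveM (is_deriveZ (2 * a) dot_deriv) (is_deriveV S0 dS).
move/(@is_derive_line0P _ _ _ (fun z => 2 * a * mxdot v z / (1 + sqnorm z))) => [_].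
rewrite DE => ->; rewrite /S /= !scale0r !addr0 [mxdot v u]mxdotC [mxdot v w]mxdotC.
by rewrite /GRing.scale/= ?exprVn; field.
Qed.

Lemma det_1_sub_mulmxC (F : comRingType) m n (A : 'M[F]_(m, n)) (B : 'M[F]_(n, m)) :
  \det (1%:M - A *m B) = \det (1%:M - B *m A).
Proof.
have lower_upper : block_mx 1%:M B A 1%:M =
    block_mx 1%:M 0 A 1%:M *m block_mx 1%:M B 0 (1%:M - A *m B).
  rewrite mulmx_block !(mul1mx, mul0mx, mulmx1, mulmx0, addr0, add0r).
  by rewrite addrC subrK.
have upper_lower : block_mx 1%:M B A 1%:M =
    block_mx 1%:M B 0 1%:M *m block_mx (1%:M - B *m A) 0 A 1%:M.
  rewrite mulmx_block !(mul1mx, mul0mx, mulmx1, mulmx0, addr0, add0r).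
  by rewrite subrK.
have := congr1 determinant lower_upper; rewrite {1}upper_lower !det_mulmx.
by rewrite !det_ublock !det_lblock !det1 !mul1r !mulr1.
Qed.

Lemma cplx_hessian_fs_potential (R : realType) m (a : R) (w : 'M[R]_(2, m)) l mu :
  cplx_hessian (fs_potential a) w l mu =
  (a / (1 + sqnorm w))%:C%C * ((l == mu)%:R -
    Complex (w re_ix l / (1 + sqnorm w)) (- (w im_ix l / (1 + sqnorm w)))
    * Complex (w re_ix mu) (w im_ix mu)).
Proof.
have : 1 + sqnorm w != 0 by rewrite gt_eqF ?sqnorm1_gt0.
pose D2 (x y : 'M[R]_(2, m)) := 2 * a * (mxdot x y / (1 + sqnorm w)
  - 2 * mxdot w x * mxdot w y / (1 + sqnorm w) ^+ 2).
have -> : cplx_hessian (fs_potential a) w l mu =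
    Complex ((D2 (ex l) (ex mu) + D2 (ey l) (ey mu)) / 4)
            ((D2 (ex l) (ey mu) - D2 (ey l) (ex mu)) / 4).
  by rewrite mxE; congr (Complex ((_ + _) / 4) ((_ - _) / 4)); exact: derive2_fs_potential.
rewrite /D2 !mxdot_delta !mxE !eqxx/= [mu == l]eq_sym; move: (1 + sqnorm w) => S S0.
by case: eqP => _ /=; apply/eqP; rewrite eq_complex/=; apply/andP; split; apply/eqP; field.
Qed.

Lemma vol_densityE (R : realType) m (a : R) (w : 'M[R]_(2, m)) :
  vol_density a w = a ^+ m / (1 + sqnorm w) ^+ m.+1.
Proof.
rewrite /vol_density; set S := 1 + sqnorm w.
have S0 : S != 0 by rewrite gt_eqF// sqnorm1_gt0.
pose u : 'cV[R[i]]_m := \col_l Complex (w re_ix l / S) (- (w im_ix l / S)).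
pose v : 'rV[R[i]]_m := \row_l Complex (w re_ix l) (w im_ix l).
have -> : cplx_hessian (fs_potential a) w = (a / S)%:C%C *: (1%:M - u *m v).
  by apply/matrixP => l mu; rewrite cplx_hessian_fs_potential !mxE big_ord1 !mxE.
have vu : v *m u = (sqnorm w / S)%:C%C%:M.
  rewrite [v *m u]mx11_scalar mxE; congr _%:M.
  rewrite /sqnorm exchange_big mulr_suml rmorph_sum/=; apply: eq_bigr => j _.
  rewrite !mxE sum_ord2; apply/eqP; rewrite eq_complex/=; apply/andP; split; apply/eqP; by field.
have S_inv : 1 - (sqnorm w / S)%:C%C = (S^-1)%:C%C :> R[i].
  apply/eqP; rewrite eq_complex/= subr0 eqxx andbT; apply/eqP.
  by move: S0; rewrite /S => S0; field.
rewrite detZ det_1_sub_mulmxC vu -raddfB det_scalar1 S_inv.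
rewrite -rmorphXn -rmorphM/= exprMn exprVn exprS invfM.
by rewrite mulrA [RHS]mulrAC.
Qed.

(** * Affine charts and polar coordinates *)

Definition tangent_chart (R : realType) m (j : 'I_m.+1) (v : 'M[R]_(2, m)) : 'M[R]_(2, m.+1) :=
  \matrix_(r, c) if unlift j c is Some c' then v r c' else 0.

Lemma chartD (R : realType) m (j : 'I_m.+1) (w v : 'M[R]_(2, m)) (h : R) :
  chart j (w + h *: v) = chart j w + h *: tangent_chart j v.
Proof.
apply/matrixP => r c; rewrite !mxE; case: unlift => [c'|]; first by rewrite !mxE.
by rewrite mulr0 addr0.
Qed.

Lemma chart_neq0 (R : realType) m (j : 'I_m.+1) (w : 'M[R]_(2, m)) : chart j w != 0.
Proof.
apply/eqP => /matrixP/(_ re_ix j)/eqP.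
by rewrite !mxE unlift_none eqxx oner_eq0.
Qed.

Lemma chart_continuous (R : realType) m (j : 'I_m.+1) : continuous (@chart R m j).
Proof.
move=> w A /nbhs_ballP[e /= e0 eA]; apply/nbhs_ballP; exists e => //= w'.
rewrite -ball_normE /ball_/= => we; apply: eA; rewrite -ball_normE /ball_/=.
apply: le_lt_trans we; apply: mx_norm_le => // r c.
rewrite !mxE; case: unlift => [c'|]; last by rewrite subrr normr0.
by have := mx_entry_norm_le (w - w') r c'; rewrite !mxE.
Qed.

Lemma pos_def_herm_Re_ge0 (R : realType) m (H : 'M[R[i]]_m) (xi : 'I_m -> R[i]) :
  pos_def_herm H -> 0 <= complex.Re (\sum_l \sum_mu H l mu * xi l * (xi mu)^*).
Proof.
move=> H_pos; pose x : 'rV[R[i]]_m := \row_l xi l.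
have -> : \sum_l \sum_mu H l mu * xi l * (xi mu)^* =
    \sum_l \sum_mu H l mu * x 0 l * (x 0 mu)^*.
  by apply: eq_bigr => l _; apply: eq_bigr => mu _; rewrite !mxE.
have [->|/H_pos/ltW] := eqVneq x 0; last by rewrite lecE => /andP[].
by rewrite big1// => l _; rewrite big1// => mu _; rewrite mxE mulr0 mul0r.
Qed.

Definition local_potential (R : realType) m (Phi : 'M[R]_(2, m.+1) -> R) (a : R) (j : 'I_m.+1)
  (w : 'M[R]_(2, m)) := fs_potential a w + Phi (chart j w).

Section SmoothChart.
Variables (R : realType) (m : nat) (Phi : 'M[R]_(2, m.+1) -> R) (a : R).
Hypothesis Phi_smooth : smooth_on [set Z | Z != 0] Phi.

Lemma diter_differentiable vs (Z : 'M[R]_(2, m.+1)) :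
  Z != 0 -> differentiable (diter Phi vs) Z.
Proof.
move=> Z0; apply: differentiable_of_partials => [|i c].
  have := near_neq0 Z0; apply: filterS => Y Y0 i c.
  by have [+ _] := Phi_smooth vs; apply.
by have [_ +] := Phi_smooth (delta_mx i c :: vs); apply.
Qed.

Lemma is_derive_diter_chart vs j (w v : 'M[R]_(2, m)) :
  is_derive w v (diter Phi vs \o chart j) (diter Phi (tangent_chart j v :: vs) (chart j w)).
Proof.
apply/(is_derive_comp_affine _ _ (chartD j w v)); apply: derivableP.
by have [+ _] := Phi_smooth vs; apply; exact: chart_neq0.
Qed.

Lemma diter_chart_differentiable vs j (w : 'M[R]_(2, m)) :
  differentiable (diter Phi vs \o chart j) w.
Proof.
apply: differentiable_of_partials => [|i c].
  by apply: filterE => y i c; case: (is_derive_diter_chart vs j y (delta_mx i c)).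
rewrite (_ : 'D_(delta_mx i c) _ = diter Phi (tangent_chart j (delta_mx i c) :: vs) \o chart j).
  apply: continuous_comp; first exact: chart_continuous.
  by have [_ +] := Phi_smooth (tangent_chart j (delta_mx i c) :: vs); apply; exact: chart_neq0.
by apply/funext => y; case: (is_derive_diter_chart vs j y (delta_mx i c)).
Qed.

Lemma derive_local_potential j v w : 'D_v (local_potential Phi a j) w =
  'D_v (fs_potential a) w + 'D_(tangent_chart j v) Phi (chart j w).
Proof.
have [fs_diff _] := twice_differentiable_fs_potential m a.
have [dPhi PhiE] := is_derive_diter_chart [::] j w v.
by rewrite deriveD ?PhiE//; exact: diff_derivable.
Qed.

Lemma twice_differentiable_local_potential j : twice_differentiable (local_potential Phi a j).
Proof.
have [fs_diff Dfs_diff] := twice_differentiable_fs_potential m a.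
split=> [w|v w].
  by apply: differentiableD => //; exact: (diter_chart_differentiable [::]).
rewrite (_ : 'D_v _ = 'D_v (fs_potential a) + (diter Phi [:: tangent_chart j v] \o chart j)).
  by apply: differentiableD => //; exact: diter_chart_differentiable.
by apply/funext => x; rewrite derive_local_potential.
Qed.

Lemma plurisubharmonic_local_potential j :
  admissible a Phi -> plurisubharmonic (local_potential Phi a j).
Proof.
move=> Phi_adm w v.
rewrite levi_form_cplx_hessian; last exact: twice_differentiable_local_potential.
by rewrite mulr_ge0//; apply: pos_def_herm_Re_ge0; exact: Phi_adm.
Qed.

End SmoothChart.

Lemma unit_circle_angle (R : realType) (x y : R) :
  x ^+ 2 + y ^+ 2 = 1 -> exists th, x = cos th /\ y = sin th.
Proof.
move=> xy1; have x1 : -1 <= x <= 1.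
  by rewrite -ler_norml -(@expr_le1 _ 2)// real_normK ?num_real// -xy1 lerDl sqr_ge0.
have sinE : sin (acos x) = `|y| by rewrite sin_acos// -xy1 addrAC subrr add0r sqrtr_sqr.
have cosE : cos (acos x) = x by rewrite acosK// in_itv.
have [y0|y0] := leP 0 y; first by exists (acos x); rewrite sinE ger0_norm.
by exists (- acos x); rewrite cosN sinN sinE ltr0_norm// opprK.
Qed.

Definition modulus (R : realType) m (Z : 'M[R]_(2, m)) (c : 'I_m) : R :=
  Num.sqrt (Z re_ix c ^+ 2 + Z im_ix c ^+ 2).

Lemma sqr_modulus (R : realType) m (Z : 'M[R]_(2, m)) c :
  modulus Z c ^+ 2 = Z re_ix c ^+ 2 + Z im_ix c ^+ 2.
Proof. by rewrite sqr_sqrtr// addr_ge0// sqr_ge0. Qed.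

Lemma polar_decomposition (R : realType) m (Z : 'M[R]_(2, m)) :
  exists th, Z = polar_mx (modulus Z) th.
Proof.
suff /choice[th thE] : forall c, exists t,
    Z re_ix c = modulus Z c * cos t /\ Z im_ix c = modulus Z c * sin t.
  by exists th; rewrite -[LHS]cplx_mx_rows; congr cplx_mx; apply/funext => c; case: (thE c).
move=> c; have := sqr_modulus Z c; have [->|r0] := eqVneq (modulus Z c) 0.
  move=> /esym/eqP; rewrite expr0n/= paddr_eq0 ?sqr_ge0// !sqrf_eq0 => /andP[/eqP-> /eqP->].
  by exists 0; rewrite !mul0r.
move=> r2; have [|t [ct st]] :=
    @unit_circle_angle R (Z re_ix c / modulus Z c) (Z im_ix c / modulus Z c).
  by rewrite !expr_div_n -mulrDl -r2 divff// sqrf_eq0.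
by exists t; rewrite -ct -st ![modulus Z c * _]mulrC !divfK.
Qed.

Lemma sqnorm_polar (R : realType) m (r th : 'I_m -> R) :
  sqnorm (polar_mx r th) = \sum_c r c ^+ 2.
Proof.
rewrite /sqnorm exchange_big; apply: eq_bigr => c _.
by rewrite sum_ord2 !mxE/= !exprMn -mulrDr cos2Dsin2 mulr1.
Qed.

Lemma sqnorm_real (R : realType) m (r : 'I_m -> R) :
  sqnorm (real_mx r) = \sum_c r c ^+ 2.
Proof. by rewrite -polar_mx0 sqnorm_polar. Qed.

(** * Bounds on the potential *)

Definition extend_at (T : Type) m (j : 'I_m.+1) (d : T) (x : 'I_m -> T) : 'I_m.+1 -> T :=
  fun c => if unlift j c is Some c' then x c' else d.

Lemma chart_polar (R : realType) m (j : 'I_m.+1) (r th : 'I_m -> R) :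
  chart j (polar_mx r th) = polar_mx (extend_at j 1 r) (extend_at j 0 th).
Proof.
apply/matrixP => i c; rewrite !mxE /extend_at; case: unlift => [c'|]; first by rewrite mxE.
by case: ifP => _; rewrite ?cos0 ?sin0 ?mulr1 ?mulr0.
Qed.

Lemma chart_real (R : realType) m (j : 'I_m.+1) (r : 'I_m -> R) :
  chart j (real_mx r) = real_mx (extend_at j 1 r).
Proof.
apply/matrixP => i c; rewrite !mxE /extend_at; case: unlift => [c'|]; first by rewrite mxE.
by case: ifP.
Qed.

Lemma tangent_chart_real (R : realType) m (j : 'I_m.+1) (v : 'I_m -> R) :
  tangent_chart j (real_mx v) = real_mx (extend_at j 0 v).
Proof.
apply/matrixP => i c; rewrite !mxE /extend_at; case: unlift => [c'|]; first by rewrite mxE.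
by case: ifP.
Qed.

Definition ones (R : realType) m : 'M[R]_(2, m) := real_mx (fun=> 1).

Lemma sqnorm_ones (R : realType) m : sqnorm (ones R m) = m%:R.
Proof. by rewrite sqnorm_real expr1n sumr_const card_ord. Qed.

Lemma chart_ones (R : realType) m (j : 'I_m.+1) : chart j (ones R m) = ones R m.+1.
Proof.
by rewrite chart_real; congr real_mx; apply/funext => c; rewrite /extend_at; case: unlift.
Qed.

Lemma real_mx_neq0 (R : realType) m (r : 'I_m -> R) (c : 'I_m) : r c != 0 -> real_mx r != 0.
Proof. by apply: contraNneq => /matrixP/(_ re_ix c); rewrite !mxE/= => ->. Qed.

Lemma ones_neq0 (R : realType) m : ones R m.+1 != 0.
Proof. by apply: (@real_mx_neq0 _ _ _ ord0); rewrite oner_eq0. Qed.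

Lemma polar_mx_neq0 (R : realType) m (r th : 'I_m -> R) :
  real_mx r != 0 -> polar_mx r th != 0.
Proof.
apply: contraNneq => rth0.
have /eqP : \sum_c r c ^+ 2 = 0.
  rewrite -(sqnorm_polar r th) rth0; apply: big1 => i _; apply: big1 => c _.
  by rewrite mxE expr0n.
rewrite psumr_eq0 => [/allP r0|c _]; last exact: sqr_ge0.
apply/eqP/matrixP => i c; rewrite !mxE; case: ifP => // _.
by have := r0 c (mem_index_enum c); rewrite sqrf_eq0 => /eqP.
Qed.

Lemma cscale_real (R : realType) m (r : 'I_m -> R) (s : R) :
  Defs.cscale s 0 (real_mx r) = real_mx (fun c => s * r c).
Proof.
apply/matrixP => i c; rewrite !mxE/=; case: ifP => _; first by rewrite mul0r subr0.
by rewrite mulr0 mul0r addr0.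
Qed.

Lemma rotZ_polar (R : realType) m (l : 'I_m.+1) (r th : 'I_m.+1 -> R) (t : R) :
  rotZ l t (polar_mx r th) = polar_mx r [eta th with l |-> th l + t].
Proof.
apply/matrixP => i c; rewrite !mxE /=.
have -> : ((c : nat) == l) = (c == l) by [].
case: eqP => [->|//] /=; case: ifP => _; rewrite ?cosD ?sinD; ring.
Qed.

Definition rotation_invariant (R : realType) m (Phi : 'M[R]_(2, m.+1) -> R) :=
  forall (p : 'I_m.+1) th Z, Z != 0 -> Phi (rotZ p th Z) = Phi Z.

Definition equal_partials_at_ones (R : realType) m (Phi : 'M[R]_(2, m.+1) -> R) :=
  forall c c' : 'I_m.+1,
  'D_(delta_mx re_ix c) Phi (ones R m.+1) = 'D_(delta_mx re_ix c') Phi (ones R m.+1).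

Section PotentialBounds.
Variables (R : realType) (m : nat) (a : R) (Phi : 'M[R]_(2, m.+1) -> R).
Hypothesis a_ge0 : 0 <= a.
Hypothesis Phi_proj : proj_invariant Phi.
Hypothesis Phi_smooth : smooth_on [set Z | Z != 0] Phi.
Hypothesis Phi_adm : admissible a Phi.
Hypothesis Phi_rot : rotation_invariant Phi.
Hypothesis Phi_partials : equal_partials_at_ones Phi.

Lemma polar_mx_invariant (r th : 'I_m.+1 -> R) : real_mx r != 0 ->
  Phi (polar_mx r th) = Phi (real_mx r).
Proof.
move=> r0; pose angles (s : seq 'I_m.+1) c := if c \in s then th c else 0.
have rotated s : uniq s -> Phi (polar_mx r (angles s)) = Phi (real_mx r).
  elim: s => [_|l s IH /= /andP[ls us]]; first by rewrite polar_mx0.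
  rewrite -(IH us) -[RHS](Phi_rot l (th l) (polar_mx_neq0 _ r0)) rotZ_polar.
  congr (Phi (polar_mx r _)); apply/funext => c; rewrite /angles in_cons /=.
  by case: eqP => [->|//]; rewrite (negbTE ls) add0r.
rewrite -(rotated _ (enum_uniq 'I_m.+1)); congr (Phi (polar_mx r _)).
by apply/funext => c; rewrite /angles mem_enum.
Qed.

Lemma torus_invariant_local_potential j : torus_invariant (local_potential Phi a j).
Proof.
move=> r th; rewrite /local_potential /fs_potential sqnorm_polar sqnorm_real chart_polar.
by rewrite polar_mx_invariant -chart_real ?chart_neq0.
Qed.

Lemma torus_psh_local_potential j : torus_psh (local_potential Phi a j).
Proof.
split; first exact: twice_differentiable_local_potential.
- exact: torus_invariant_local_potential.
- exact: plurisubharmonic_local_potential.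
Qed.

Lemma derive_ones_radial : 'D_(ones R m.+1) Phi (ones R m.+1) = 0.
Proof.
have [//] : is_derive (ones R m.+1) (ones R m.+1) Phi 0.
apply/is_derive_line0P; apply: (@near_eq_is_derive R R R (cst (Phi (ones R m.+1)))).
have : \forall t \near (0 : R), `|t| < 1 by apply: nbhs0_lt; exact: ltr01.
apply: filterS => t t1 /=.
have t0 : 1 + t != 0 by rewrite gt_eqF//; move: t1; rewrite ltr_norml; lra.
rewrite -(@Phi_proj (1 + t) 0 (ones R m.+1)) ?ones_neq0//; last first.
  by apply: contra t0 => /eqP[->].
congr Phi; rewrite cscale_real; apply/matrixP => i j; rewrite !mxE.
by case: ifP => _; rewrite ?mulr1// mulr0 addr0.
Qed.

Lemma derive_real_ones_eq0 (v : 'I_m.+1 -> R) : 'D_(real_mx v) Phi (ones R m.+1) = 0.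
Proof.
have partialsE (u : 'I_m.+1 -> R) : 'D_(real_mx u) Phi (ones R m.+1) =
    (\sum_c u c) * 'D_(delta_mx re_ix ord0) Phi (ones R m.+1).
  rewrite (derive_ex_ey _ (diter_differentiable Phi_smooth [::] (ones_neq0 R m))) mulr_suml.
  by apply: eq_bigr => c _; rewrite !mxE/= mul0r addr0 [in LHS](Phi_partials c ord0).
have := derive_ones_radial; rewrite !partialsE sumr_const card_ord => /eqP.
by rewrite mulf_eq0 pnatr_eq0/= => /eqP ->; rewrite mulr0.
Qed.

Lemma derive_local_potential_ones j (v : 'I_m -> R) :
  'D_(real_mx v) (local_potential Phi a j) (ones R m) = 2 * a / m.+1%:R * \sum_l v l.
Proof.
rewrite derive_local_potential// chart_ones tangent_chart_real derive_real_ones_eq0 addr0.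
rewrite derive_fs_potential sqnorm_ones nat1r mulrAC; congr (_ * _).
by rewrite /mxdot sum_ord2 [X in _ + X]big1 ?addr0 => [|c _];
  [apply: eq_bigr => c _; rewrite !mxE mulr1|rewrite !mxE mul0r].
Qed.

Lemma local_potential_ones j :
  local_potential Phi a j (ones R m) = a * ln m.+1%:R + Phi (ones R m.+1).
Proof. by rewrite /local_potential /fs_potential sqnorm_ones nat1r chart_ones. Qed.

(* The tangent inequality at the symmetric point, in logarithmic coordinates. *)
Lemma local_potential_ge j (w : 'M[R]_(2, m)) : (forall l, 0 < modulus w l) ->
  a * ln m.+1%:R + Phi (ones R m.+1) + 2 * a / m.+1%:R * \sum_l ln (modulus w l) <=
  local_potential Phi a j w.
Proof.
have [th wE] := polar_decomposition w; rewrite [in leRHS]wE torus_invariant_local_potential.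
move: (modulus w) => r r0.
have := torus_psh_log_tangent_le (torus_psh_local_potential j) (fun=> 1) (fun l => ln (r l)).
under [X in _ + 'D_(real_mx X) _ _]eq_fun do rewrite mulr1.
under [X in _ <= local_potential _ _ _ (real_mx X)]eq_fun do rewrite mul1r lnK ?posrE//.
by rewrite derive_local_potential_ones local_potential_ones.
Qed.

Lemma polydisc_representative Z : Z != 0 -> exists j (r : 'I_m -> R),
  (forall l, 0 <= r l <= 1) /\ Phi Z = Phi (chart j (real_mx r)).
Proof.
move=> Z0; have [th ZE] := polar_decomposition Z; set r := modulus Z in ZE.
have r_ge0 c : 0 <= r c by exact: sqrtr_ge0.
pose j := [arg max_(i > ord0) r i]%O.
have r_le c : r c <= r j by rewrite /j; case: arg_maxP => //= i _; apply.
have rj0 : r j != 0.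
  apply: contra Z0 => /eqP rj0; rewrite ZE; apply/eqP/matrixP => i c; rewrite !mxE.
  suff -> : r c = 0 by rewrite !mul0r if_same.
  by apply/eqP; rewrite eq_le r_ge0 -rj0 r_le.
have rj_gt0 : 0 < r j by rewrite lt_neqAle eq_sym rj0 r_ge0.
exists j, (fun l => (r j)^-1 * r (lift j l)); split=> [l|].
  by rewrite mulr_ge0 ?invr_ge0//= mulrC ler_pdivrMr// mul1r r_le.
have real_r0 := real_mx_neq0 rj0.
rewrite ZE polar_mx_invariant// -(@Phi_proj (r j)^-1 0)//; last first.
  by apply: contra rj0 => /eqP[/eqP]; rewrite invr_eq0.
congr Phi; rewrite cscale_real chart_real; congr real_mx; apply/funext => c.
by rewrite /extend_at; case: unliftP => [c' ->|->]//; rewrite mulVf.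
Qed.

Lemma potential_le_ones Z : Z != 0 -> Phi Z <= Phi (ones R m.+1) + a * ln m.+1%:R.
Proof.
move=> /polydisc_representative[j [r [r01 ->]]].
have := torus_psh_real_mx_le (torus_psh_local_potential j) r01.
rewrite -/(ones R m) local_potential_ones [leRHS]addrC; apply: le_trans.
by rewrite lerDr mulr_ge0// ln_ge0// lerDl sqnorm_ge0.
Qed.

Hypothesis Phi_sup : sup [set Phi Z | Z in [set Z | Z != 0]] = 0.

(* [sup] of a set that is not bounded above is [0] by convention, so the upper bound
   is also what gives the hypothesis on the supremum its meaning. *)
Lemma potential_le0 Z : Z != 0 -> Phi Z <= 0.
Proof.
move=> Z0; rewrite -Phi_sup; apply: sup_upper_bound; last by exists Z.
split; first by exists (Phi Z), Z.
by exists (Phi (ones R m.+1) + a * ln m.+1%:R) => _ [Y Y0 <-]; exact: potential_le_ones.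
Qed.

Lemma potential_ones_ge : 0 <= a * ln m.+1%:R + Phi (ones R m.+1).
Proof.
rewrite addrC -Phi_sup; apply: ge_sup.
  by exists (Phi (ones R m.+1)), (ones R m.+1) => //; exact: ones_neq0.
by move=> _ [Y Y0 <-]; exact: potential_le_ones.
Qed.

Lemma potential_chart_ge j (w : 'M[R]_(2, m)) : (forall l, 0 < modulus w l) ->
  2 * a / m.+1%:R * \sum_l ln (modulus w l) - a * ln (1 + sqnorm w) <= Phi (chart j w).
Proof.
move=> /(local_potential_ge j); have := potential_ones_ge.
by rewrite /local_potential /fs_potential; move: (_ / _ * \sum_l _) => s; lra.
Qed.

End PotentialBounds.

Lemma derive_permZ_ones (R : realType) m (Phi : 'M[R]_(2, m.+1) -> R) (s : nat -> nat)
    (c c' : 'I_m.+1) :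
  differentiable Phi (ones R m.+1) ->
  injective s -> (forall p, (p < m.+1)%N -> (s p < m.+1)%N) -> s c = c' ->
  (forall Z, Z != 0 -> Phi (permZ s Z) = Phi Z) ->
  'D_(delta_mx re_ix c) Phi (ones R m.+1) = 'D_(delta_mx re_ix c') Phi (ones R m.+1).
Proof.
move=> dPhi s_inj s_lt sc Phi_s.
have permZ_ones : permZ s (ones R m.+1) = ones R m.+1 by apply/matrixP => i j; rewrite !mxE.
have permZ_delta : permZ s (delta_mx re_ix c' : 'M[R]_(2, m.+1)) = delta_mx re_ix c.
  apply/matrixP => i j; rewrite !mxE; congr ((_ && _)%:R).
  by rewrite -!val_eqE/= inordK ?s_lt// -sc (inj_eq s_inj).
have permZD h : permZ s (ones R m.+1 + h *: delta_mx re_ix c') =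
    permZ s (ones R m.+1) + h *: permZ s (delta_mx re_ix c').
  by apply/matrixP => i j; rewrite !mxE.
have /(is_derive_comp_affine _ _ permZD)[_] :
    is_derive (permZ s (ones R m.+1)) (permZ s (delta_mx re_ix c')) Phi
      ('D_(delta_mx re_ix c) Phi (ones R m.+1)).
  by rewrite permZ_ones permZ_delta; apply/derivableP/diff_derivable.
move=> <-; apply: near_eq_derive.
by have := near_neq0 (ones_neq0 R m); apply: filterS => Z Z0 /=; rewrite Phi_s.
Qed.

Lemma divnMDmod n h p : (0 < n)%N -> ((h * n + p %% n) %/ n = h)%N.
Proof. by move=> n0; rewrite divnMDl// divn_small ?addn0 ?ltn_mod. Qed.

Lemma block_swapE n i j p : (0 < n)%N ->
  (block_swap n i j p = transp i j (p %/ n) * n + p %% n)%N.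
Proof.
by move=> n0; rewrite /block_swap /transp; do 2 case: eqP => // _; rewrite -divn_eq.
Qed.

Lemma transp_involutive p q : involutive (transp p q).
Proof.
move=> c; rewrite [transp p q c]/transp; case: eqP => [->|cp]; [|case: eqP => [->|cq]].
- by rewrite /transp eqxx; case: eqP.
- by rewrite /transp eqxx.
- by rewrite /transp; move/eqP/negbTE: cp => ->; move/eqP/negbTE: cq => ->.
Qed.

Lemma transp_lt N p q c : (p < N)%N -> (q < N)%N -> (c < N)%N -> (transp p q c < N)%N.
Proof. by rewrite /transp; do 2 case: eqP => // _. Qed.

Lemma block_swap_involutive n i j : (0 < n)%N -> involutive (block_swap n i j).
Proof.
move=> n0 p; rewrite !block_swapE// divnMDmod//.
by rewrite modnMDl modn_mod transp_involutive -divn_eq.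
Qed.

Lemma block_swap_lt k n i j p : (0 < n)%N -> (i < k)%N -> (j < k)%N -> (p < k * n)%N ->
  (block_swap n i j p < k * n)%N.
Proof.
move=> n0 ik jk pkn; rewrite block_swapE// -ltn_divLR// divnMDmod//.
by rewrite transp_lt// ltn_divLR.
Qed.

Lemma Gnk_rotation_invariant (R : realType) k n m (Phi : 'M[R]_(2, m.+1) -> R) :
  Gnk_invariant k n Phi -> rotation_invariant Phi.
Proof. by move=> Phi_inv p th Z Z0; apply: Phi_inv => //; exact: Gnk_rot. Qed.

Lemma Gnk_equal_partials_at_ones (R : realType) k n m (Phi : 'M[R]_(2, m.+1) -> R) :
  (0 < n)%N -> m.+1 = (k * n)%N -> Gnk_invariant k n Phi ->
  differentiable Phi (ones R m.+1) -> equal_partials_at_ones Phi.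
Proof.
move=> n0 mkn Phi_inv dPhi c c'.
have block_lt (d : 'I_m.+1) : (d %/ n < k)%N by rewrite ltn_divLR// -mkn.
pose s := block_swap n (c %/ n) (c' %/ n).
have s_lt p : (p < m.+1)%N -> (s p < m.+1)%N by rewrite mkn; exact: block_swap_lt.
pose d : 'I_m.+1 := Ordinal (s_lt c (ltn_ord c)).
have d_block : (d %/ n = c' %/ n)%N.
  by rewrite /= /s block_swapE// /transp eqxx divnMDmod.
rewrite (@derive_permZ_ones _ _ _ s c d)//; last 2 first.
- exact/inv_inj/block_swap_involutive.
- by move=> Z; apply: Phi_inv; exact: Gnk_swap.
rewrite (@derive_permZ_ones _ _ _ (transp d c') d c')//.
- exact/inv_inj/transp_involutive.
- by move=> p; exact: transp_lt.
- by rewrite /transp eqxx.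
- by move=> Z; apply: Phi_inv; exact: Gnk_transp.
Qed.

(** * Comparison of iterated integrals *)

(* No measurability is needed: the integral of a nonnegative function is a supremum
   over the simple functions below it. *)
Lemma le_ge0_integral d (T : measurableType d) (R : realType)
    (mu : {measure set T -> \bar R}) (f g : T -> \bar R) :
  (forall x, 0 <= f x)%E -> (forall x, f x <= g x)%E ->
  (\int[mu]_x f x <= \int[mu]_x g x)%E.
Proof.
move=> f0 fg; have g0 x : (0 <= g x)%E by exact: le_trans (fg x).
rewrite !ge0_integralTE//; apply: ereal_sup_le; apply: image_subset => h h_le x.
exact: le_trans (fg x).
Qed.

Lemma ae_le_ge0_integral d (T : measurableType d) (R : realType)
    (mu : {measure set T -> \bar R}) (f g : T -> \bar R) :
  (forall x, 0 <= f x)%E -> (forall x, 0 <= g x)%E -> measurable_fun setT g ->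
  {ae mu, forall x, (f x <= g x)%E} ->
  (\int[mu]_x f x <= \int[mu]_x g x)%E.
Proof.
move=> f0 g0 mg [N [mN muN0 subN]]; pose h := cst +oo%E \_ N : T -> \bar R.
have h0 x : (0 <= h x)%E by apply: erestrict_ge0 => y _; exact: leey.
have mh : measurable_fun setT h by apply/(measurable_restrictT _ mN); exact: measurable_cst.
have -> : (\int[mu]_x g x = \int[mu]_x (g x + h x))%E.
  by rewrite ge0_integralD// -[X in (_ + X)%E]integral_mkcond integral_cst// muN0 mule0 adde0.
apply: le_ge0_integral => // x; rewrite /h patchE; case: ifPn => [_|].
  by rewrite addey ?leey// gt_eqF// (lt_le_trans _ (g0 x))// ltNyr.
by rewrite adde0 notin_setE => xN; apply: contrapT => /subN.
Qed.

Lemma iter_int_ge0 (R : realType) d (F : (nat -> R) -> \bar R) :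
  (forall x, 0 <= F x)%E -> (0 <= iter_int d F)%E.
Proof. by elim: d F => [|d IH] F F0 //=; apply: integral_ge0 => t _; exact: IH. Qed.

Lemma iter_int_le_prod (R : realType) (q : R -> R) d (F : (nat -> R) -> \bar R) (K : R) :
  (forall t, 0 <= q t) -> lebesgue_measure.-integrable setT (EFin \o q) ->
  0 <= K -> (forall x, 0 <= F x)%E ->
  (forall x : nat -> R, (forall i, (i < d)%N -> x i != 0) ->
    (F x <= (K * \prod_(i < d) q (x i))%:E)%E) ->
  (iter_int d F <= (K * (\int[lebesgue_measure]_t q t) ^+ d)%:E)%E.
Proof.
move=> q_ge0 q_int; set J := (\int[lebesgue_measure]_t q t)%R.
have J0 : 0 <= J by apply: Rintegral_ge0.
have intq : (\int[lebesgue_measure]_t (q t)%:E)%E = J%:E.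
  by rewrite -[LHS]fineK//; exact: integrable_fin_num.
elim: d F K => [|d IH] F K K0 F0 FK.
  by have := FK (fun=> 0); rewrite big_ord0 expr0; apply.
pose Ft t x := F (fun i => if i == d then t else x i).
have Ft_le t : t != 0 -> (iter_int d (Ft t) <= (K * q t * J ^+ d)%:E)%E.
  move=> t0; apply: IH => [||x x0]; [by rewrite mulr_ge0|by move=> x; exact: F0|].
  apply: le_trans (FK _ _) _ => [i|].
    by rewrite ltnS leq_eqVlt; case: eqP => [_ _|_ /= /x0].
  rewrite lee_fin big_ord_recr/= eqxx -mulrA [q t * _]mulrC le_eqVlt.
  apply/orP; left; apply/eqP; congr (_ * (_ * _)).
  by apply: eq_bigr => i _; rewrite (ltn_eqF (ltn_ord i)).
apply: (@le_trans _ _ (\int[lebesgue_measure]_t ((K * J ^+ d)%:E * (q t)%:E))%E).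
  apply: ae_le_ge0_integral => [t|t||].
  - by apply: iter_int_ge0 => x; exact: F0.
  - by rewrite -EFinM lee_fin !mulr_ge0// exprn_ge0.
  - apply/measurable_EFinP; apply: measurable_funM => //.
    by apply/measurable_EFinP; exact: measurable_int q_int.
  - exists [set 0]; split=> [||t /= ft]; [exact: measurable_set1|exact: lebesgue_measure_set1|].
    apply: contrapT => /eqP t0; apply: ft; rewrite -EFinM mulrAC; exact: Ft_le.
rewrite ge0_integralZl//.
- by rewrite intq -EFinM -mulrA -exprSr.
- exact: measurable_int q_int.
- by move=> t _; rewrite lee_fin.
- by rewrite lee_fin mulr_ge0// exprn_ge0.
Qed.

(** * Integrals of even functions *)

Definition annulus (R : realType) (n : nat) : set R :=
  [set x | n.+2%:R^-1 <= `|x| <= n.+2%:R].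

Lemma annulusE (R : realType) n : annulus n =
  `[n.+2%:R^-1, n.+2%:R] `|` `[- n.+2%:R, - n.+2%:R^-1] :> set R.
Proof.
apply/seteqP; split=> x; rewrite /annulus /= !in_itv/=; last first.
  case=> /andP[ax xb]; first by rewrite ger0_norm ?ax// (le_trans _ ax)// ltW.
  by rewrite ler0_norm 1?lerNr ?xb 1?lerNl ?ax// (le_trans xb)// oppr_le0 ltW.
case: (lerP 0 x) => x0; first by rewrite ger0_norm//; left.
by rewrite ltr0_norm// lerNr lerNl => /andP[xb bx]; right; rewrite xb bx.
Qed.

Lemma measurable_annulus (R : realType) n : measurable (annulus n : set R).
Proof. by rewrite annulusE; exact: measurableU. Qed.

Lemma nondecreasing_annulus (R : realType) : nondecreasing_seq (@annulus R).
Proof.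
move=> m n mn; apply/subsetPset => x /andP[mx xm].
have le_mn : m.+2%:R <= n.+2%:R :> R by rewrite ler_nat !ltnS.
by rewrite /annulus /= (le_trans _ mx) ?(le_trans xm)// lef_pV2 ?posrE.
Qed.

Lemma bigcup_annulus (R : realType) : \bigcup_n annulus n = [set: R] `\ 0.
Proof.
apply/seteqP; split=> [x [n _ /andP[nx _]]|x [_ /= /eqP x0]].
  by split=> // x0; move: nx; rewrite x0 normr0 leNgt invr_gt0 ltr0n.
have x_gt0 : 0 < `|x| by rewrite normr_gt0.
have xV_gt0 : 0 < `|x|^-1 by rewrite invr_gt0.
pose n := Num.bound (`|x| + `|x|^-1).
have n_gt : `|x| + `|x|^-1 < n.+2%:R.
  apply: lt_le_trans (archi_boundP _) _; first by rewrite addr_ge0 ?ltW.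
  by rewrite ler_nat -addn2 leq_addr.
exists n => //; apply/andP; split; last by lra.
by rewrite -[leRHS]invrK lef_pV2 ?posrE//; lra.
Qed.

Section SymfunFTC.
Variables (R : realType) (f F : R -> R).
Hypothesis f_ge0 : forall x, 0 <= f x.
Hypothesis f_sym : f =1 f \o -%R.
Hypothesis f_meas : measurable_fun setT f.
Hypothesis f_cont : forall x : R, 0 < x -> {for x, continuous f}.
Hypothesis dF : forall x : R, 0 < x -> is_derive x (1 : R) F (f x).

Local Notation mu := (@lebesgue_measure R).

Lemma integral_itv_FTC (a b : R) : 0 < a -> a < b ->
  (\int[mu]_(x in `[a, b]) (f x)%:E = (F b - F a)%:E)%E.
Proof.
move=> a0 ab; have F_cont (x : R) : 0 < x -> {for x, continuous F}.
  by move=> /dF[/derivable1_diffP/differentiable_continuous].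
have b0 : 0 < b by exact: lt_trans ab.
rewrite (@continuous_FTC2 R f F)//.
- apply: continuous_in_subspaceT => x; rewrite inE/= in_itv/= => /andP[ax _].
  by apply: f_cont; exact: lt_le_trans ax.
- split=> [x||].
  + by rewrite in_itv/= => /andP[ax _]; case: (dF (lt_trans a0 ax)).
  + by apply: cvg_at_right_filter; exact: F_cont.
  + by apply: cvg_at_left_filter; exact: F_cont.
- move=> x; rewrite in_itv/= => /andP[ax _]; rewrite derive1E.
  by case: (dF (lt_trans a0 ax)).
Qed.

Lemma integral_itvN_FTC (a b : R) : 0 < a -> a < b ->
  (\int[mu]_(x in `[(- b)%R, (- a)%R]) (f x)%:E = (F b - F a)%:E)%E.
Proof.
move=> a0 ab; rewrite integration_by_substitution_oppr ?(ltW ab)//.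
  rewrite -integral_itv_FTC//; apply: eq_integral => x _.
  by rewrite -(f_sym x).
apply: continuous_in_subspaceT => x; rewrite inE/= in_itv/= => /andP[_ xa].
have -> : f = f \o -%R by apply/funext.
apply: continuous_comp; first exact: opp_continuous.
by apply: f_cont; rewrite oppr_gt0 (le_lt_trans xa)// oppr_lt0.
Qed.

Lemma integral_annulus_FTC n :
  (\int[mu]_(x in annulus n) (f x)%:E = (2 * (F n.+2%:R - F n.+2%:R^-1))%:E)%E.
Proof.
have b0 : 0 < n.+2%:R^-1 :> R by rewrite invr_gt0.
have bV : n.+2%:R^-1 < n.+2%:R :> R by rewrite (@lt_trans _ _ 1) ?invf_lt1 ?ltr1n.
rewrite annulusE ge0_integral_setU//; last 3 first.
- exact/measurable_EFinP/measurable_funTS.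
- by move=> x _; rewrite lee_fin.
- apply/disj_setPS => x [] /=; rewrite !in_itv/= => /andP[ax _] /andP[_ xa].
  by have := lt_le_trans b0 (le_trans ax xa); rewrite oppr_gt0 ltNge ltW.
by rewrite integral_itv_FTC ?integral_itvN_FTC// -EFinD -mulr2n mulr_natl.
Qed.

Lemma symfun_integral_le (l u : R) :
  (forall x : R, 0 < x -> l <= F x <= u) -> (\int[mu]_x (f x)%:E <= (2 * (u - l))%:E)%E.
Proof.
move=> F_bound; have mf : measurable_fun setT (EFin \o f) by exact/measurable_EFinP.
have -> : (\int[mu]_x (f x)%:E = \int[mu]_(x in \bigcup_n annulus n) (f x)%:E)%E.
  rewrite bigcup_annulus; apply: ge0_negligible_integral => // [x _|].
    by rewrite lee_fin.
  exact: lebesgue_measure_set1.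
have annulus_le n : (\int[mu]_(x in annulus n) (f x)%:E <= (2 * (u - l))%:E)%E.
  have /andP[_ Fb] := F_bound n.+2%:R (ltr0Sn _ _).
  have /andP[Fa _] : l <= F n.+2%:R^-1 <= u by rewrite F_bound ?invr_gt0.
  by rewrite integral_annulus_FTC lee_fin; lra.
have annulus_cvg : (\int[mu]_(x in annulus n) (f x)%:E)%E @[n --> \oo] -->
    (\int[mu]_(x in \bigcup_n annulus n) (f x)%:E)%E.
  apply: ge0_nondecreasing_set_cvg_integral => [||n|n x _].
  - exact: nondecreasing_annulus.
  - exact: measurable_annulus.
  - exact: measurable_funTS.
  - by rewrite lee_fin.
rewrite -(cvg_lim _ annulus_cvg)//; apply: lime_le; last exact: nearW.
by apply/cvg_ex; eexists; exact: annulus_cvg.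
Qed.

End SymfunFTC.

(* Meaningless at [t = 0], where [powR] gives [0] or [1]. *)
Definition radial_weight (R : realType) (al ga t : R) : R :=
  `|t| `^ (- al) * (1 + t ^+ 2) `^ (- ga).

Lemma radial_weight_ge0 (R : realType) (al ga t : R) : 0 <= radial_weight al ga t.
Proof. by rewrite mulr_ge0 ?powR_ge0. Qed.

Lemma radial_weightE (R : realType) (al ga t : R) : t != 0 ->
  radial_weight al ga t = expR (- (al * ln `|t|) - ga * ln (1 + t ^+ 2)).
Proof.
move=> t0; have st0 : 0 < 1 + t ^+ 2 by rewrite ltr_pwDl// sqr_ge0.
by rewrite expRD /radial_weight /powR normr_eq0 (negbTE t0) gt_eqF// !mulNr.
Qed.

Lemma measurable_radial_weight (R : realType) (al ga : R) :
  measurable_fun setT (radial_weight al ga).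
Proof.
apply: measurable_funM; apply: (measurableT_comp (measurable_powR _)) => //.
by apply: measurable_funD => //; exact: measurable_funX.
Qed.

Lemma continuous_powR (R : realType) (p x : R) : 0 < x -> {for x, continuous (@powR R ^~ p)}.
Proof.
move=> x0; apply: differentiable_continuous; apply/derivable1_diffP.
by case: (is_derive1_powR p x0).
Qed.

Definition decay (R : realType) (b c t : R) : R :=
  `|t| `^ (b - 1) * (1 + `|t| `^ b) `^ (- c - 1).

Definition decay_primitive (R : realType) (b c t : R) : R :=
  - (c * b)^-1 * (1 + t `^ b) `^ (- c).

Section DecayIntegral.
Variables (R : realType) (b c : R).
Hypotheses (b0 : 0 < b) (c0 : 0 < c).

Let one_powR_gt0 (t : R) : 0 < 1 + t `^ b. Proof. by rewrite ltr_pwDl// powR_ge0. Qed.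

Lemma is_derive_decay_primitive (t : R) : 0 < t ->
  is_derive t (1 : R) (decay_primitive b c) (decay b c t).
Proof.
move=> t0; pose S (s : R) := 1 + s `^ b.
have dS : is_derive t (1 : R) S (b * t `^ (b - 1)).
  rewrite -[X in is_derive _ _ _ X]add0r.
  exact: is_deriveD (is_derive_cst _ _ _) (is_derive1_powR b t0).
have dpow : is_derive (S t) (1 : R) (@powR R ^~ (- c)) (- c * S t `^ (- c - 1)).
  by apply: is_derive1_powR; exact: one_powR_gt0.
have := is_deriveZ (- (c * b)^-1) (is_derive1_comp dpow dS).
move/is_derive_eq; apply; rewrite /decay gtr0_norm// /GRing.scale/=.
by field; rewrite !gt_eqF.
Qed.

Lemma continuous_decay (t : R) : 0 < t -> {for t, continuous (decay b c)}.
Proof.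
move=> t0; have nt0 : 0 < `|t| by rewrite normr_gt0 gt_eqF.
have cpow p : {for t, continuous (fun s : R => `|s| `^ p)}.
  apply: (@continuous_comp R R R (fun s : R => `|s|) (@powR R ^~ p) t).
    exact: norm_continuous.
  exact: continuous_powR.
apply: continuousM; first exact: cpow.
apply: (@continuous_comp _ _ _ (fun s : R => 1 + `|s| `^ b) (@powR R ^~ (- c - 1))).
  by apply: continuousD; [exact: cst_continuous|exact: cpow].
by apply: continuous_powR; exact: one_powR_gt0.
Qed.

Lemma measurable_decay : measurable_fun setT (decay b c).
Proof.
apply: measurable_funM; apply: (measurableT_comp (measurable_powR _)) => //.
by apply: measurable_funD => //; exact: (measurableT_comp (measurable_powR _)).
Qed.

Lemma integral_decay_le :
  (\int[lebesgue_measure]_t (decay b c t)%:E <= (2 * (c * b)^-1)%:E)%E.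
Proof.
rewrite -[(c * b)^-1]opprK -[- - _]sub0r.
apply: (@symfun_integral_le _ (decay b c) (decay_primitive b c)).
- by move=> t; rewrite mulr_ge0 ?powR_ge0.
- by move=> t; rewrite /decay /= normrN.
- exact: measurable_decay.
- exact: continuous_decay.
- exact: is_derive_decay_primitive.
move=> t t0; have cb0 : 0 < (c * b)^-1 by rewrite invr_gt0 mulr_gt0.
have pow_le1 : (1 + t `^ b) `^ (- c) <= 1.
  by rewrite -[leRHS](powRr0 (1 + t `^ b)) ler_powR ?lerDl ?powR_ge0// oppr_le0 ltW.
rewrite /decay_primitive mulNr lerN2 oppr_le0 mulr_ge0 ?powR_ge0 ?(ltW cb0)// andbT.
by rewrite -[leRHS]mulr1 ler_wpM2l// ltW.
Qed.

Lemma radial_weight_le_decay (t : R) :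
  radial_weight (1 - b) (b / 2 * (c + 1)) t <= 2 `^ (c + 1) * decay b c t.
Proof.
rewrite /radial_weight /decay opprB mulrCA ler_wpM2l ?powR_ge0//.
have S_ge1 : 1 <= 1 + t ^+ 2 by rewrite lerDl sqr_ge0.
have S_gt0 : 0 < 1 + t ^+ 2 by exact: lt_le_trans S_ge1.
have base_le : 1 + `|t| `^ b <= 2 * (1 + t ^+ 2) `^ (b / 2).
  have pow_mono x : 0 <= x <= 1 + t ^+ 2 -> x `^ (b / 2) <= (1 + t ^+ 2) `^ (b / 2).
    by move=> /andP[x0 xS]; rewrite ge0_ler_powR ?nnegrE ?divr_ge0 ?(ltW b0) ?(ltW S_gt0).
  have one_le : 1 <= (1 + t ^+ 2) `^ (b / 2).
    by rewrite -[leLHS](powRr0 (1 + t ^+ 2)) ler_powR// divr_ge0// ltW.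
  have norm_le : `|t| `^ b <= (1 + t ^+ 2) `^ (b / 2).
    have -> : `|t| `^ b = (t ^+ 2) `^ (b / 2).
      by rewrite -[t ^+ 2]real_normK ?num_real// -powR_mulrn// -powRrM mulrCA divff// mulr1.
    by rewrite pow_mono// sqr_ge0 lerDr ler01.
  by rewrite mulr_natl mulr2n lerD.
have pow_le : (1 + `|t| `^ b) `^ (c + 1) <= 2 `^ (c + 1) * (1 + t ^+ 2) `^ (b / 2 * (c + 1)).
  rewrite powRrM -powRM ?powR_ge0//; apply: ge0_ler_powR base_le; first by rewrite addr_ge0// ltW.
    by rewrite nnegrE ltW ?one_powR_gt0.
  by rewrite nnegrE mulr_ge0 ?powR_ge0.
by rewrite -opprD !powRN -[_^-1]mul1r ler_pdivrMr ?powR_gt0// mulrAC ler_pdivlMr ?mul1r.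
Qed.

End DecayIntegral.

Lemma integrable_radial_weight (R : realType) (al ga : R) : al < 1 -> 1 < al + 2 * ga ->
  lebesgue_measure.-integrable setT (EFin \o radial_weight al ga).
Proof.
move=> al_lt1 al_ga; pose b := 1 - al; pose c := 2 * ga / b - 1.
have b0 : 0 < b by rewrite subr_gt0.
have c0 : 0 < c by rewrite subr_gt0 ltr_pdivlMr// mul1r /b; lra.
have alE : al = 1 - b by rewrite /b; ring.
have gaE : ga = b / 2 * (c + 1) by rewrite /c; field; rewrite gt_eqF.
have weight_le t : radial_weight al ga t <= 2 `^ (c + 1) * decay b c t.
  by rewrite [in leLHS]alE [in leLHS]gaE radial_weight_le_decay.
apply/integrableP; split; first by apply/measurable_EFinP; exact: measurable_radial_weight.
apply: (@le_lt_trans _ _ (\int[lebesgue_measure]_t ((2 `^ (c + 1))%:E * (decay b c t)%:E))%E).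
  apply: le_ge0_integral => t; first by rewrite lee_fin normr_ge0.
  by rewrite -EFinM lee_fin ger0_norm ?weight_le// radial_weight_ge0.
rewrite ge0_integralZl//.
- apply: (@le_lt_trans _ _ ((2 `^ (c + 1))%:E * (2 * (c * b)^-1)%:E)%E).
    by apply: lee_wpmul2l; [rewrite lee_fin powR_ge0|exact: (integral_decay_le b0 c0)].
  by rewrite -EFinM ltry.
- by apply/measurable_EFinP; exact: measurable_decay.
- by move=> t _; rewrite lee_fin mulr_ge0 ?powR_ge0.
Qed.

(** * The integral estimate *)

Lemma big_pairs (T : Type) (idx : T) (op : Monoid.law idx) m (F : nat -> T) :
  \big[op/idx]_(i < 2 * m) F i = \big[op/idx]_(l < m) op (F (2 * l + 0)%N) (F (2 * l + 1)%N).
Proof.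
elim: m => [|m IH]; first by rewrite muln0 !big_ord0.
rewrite [RHS]big_ord_recr/= -IH -!(big_mkord xpredT F) mulnS !big_nat_recr//=.
by rewrite addn0 addn1 Monoid.mulmA.
Qed.

Lemma modulus_gt0 (R : realType) m (w : 'M[R]_(2, m)) l :
  w re_ix l != 0 -> 0 < modulus w l.
Proof. by move=> x0; rewrite sqrtr_gt0 ltr_pwDl ?sqr_ge0// exprn_even_gt0. Qed.

Lemma ln_norm_add_le_modulus (R : realType) m (w : 'M[R]_(2, m)) l :
  w re_ix l != 0 -> w im_ix l != 0 ->
  ln `|w re_ix l| + ln `|w im_ix l| <= 2 * ln (modulus w l).
Proof.
move=> x0 y0; have r0 := modulus_gt0 x0.
rewrite -lnM ?posrE ?normr_gt0// mulr_natl -lnXn// ler_ln ?posrE ?exprn_gt0//; last first.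
  by rewrite mulr_gt0 ?normr_gt0.
rewrite sqr_modulus -(real_normK (num_real (w re_ix l))) -(real_normK (num_real (w im_ix l))).
move: `|w re_ix l| `|w im_ix l| (normr_ge0 (w re_ix l)) (normr_ge0 (w im_ix l)) => x y x_ge0 y_ge0.
by have := sqr_ge0 (x - y); have := mulr_ge0 x_ge0 y_ge0; rewrite sqrrB; lra.
Qed.

Lemma ln_1sqr_le_sqnorm (R : realType) m (w : 'M[R]_(2, m)) r c :
  ln (1 + w r c ^+ 2) <= ln (1 + sqnorm w).
Proof.
rewrite ler_ln ?posrE ?sqnorm1_gt0//; last by rewrite ltr_pwDl// sqr_ge0.
rewrite lerD2l /sqnorm (bigD1 r)//= (bigD1 c)//= -addrA lerDl addr_ge0//.
  by apply: sumr_ge0 => i _; exact: sqr_ge0.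
by apply: sumr_ge0 => i _; apply: sumr_ge0 => j _; exact: sqr_ge0.
Qed.

Lemma le_prod_radial_weight (R : realType) m (al ga B : R) (w : 'M[R]_(2, m)) :
  0 <= al -> 0 <= ga -> ga * (2 * m%:R) <= B -> (forall r c, w r c != 0) ->
  expR (- (2 * al * \sum_l ln (modulus w l)) - B * ln (1 + sqnorm w)) <=
  \prod_l (radial_weight al ga (w re_ix l) * radial_weight al ga (w im_ix l)).
Proof.
move=> al0 ga0 gaB w0; set L := ln (1 + sqnorm w).
have L0 : 0 <= L by rewrite ln_ge0// lerDl sqnorm_ge0.
under eq_bigr do rewrite !radial_weightE// -expRD.
rewrite -expR_sum ler_expR.
apply: (@le_trans _ _ (\sum_(l < m) (- (2 * al * ln (modulus w l)) - ga * (2 * L)))).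
  rewrite big_split/= sumr_const card_ord sumrN -mulr_sumr lerD2l mulNrn lerN2 -(mulr_natr _ m).
  have -> : ga * (2 * L) * m%:R = ga * (2 * m%:R) * L by ring.
  by rewrite ler_wpM2r.
apply: ler_sum => l _.
have re_le : ga * ln (1 + w re_ix l ^+ 2) <= ga * L by rewrite ler_wpM2l// ln_1sqr_le_sqnorm.
have im_le : ga * ln (1 + w im_ix l ^+ 2) <= ga * L by rewrite ler_wpM2l// ln_1sqr_le_sqnorm.
have : al * (ln `|w re_ix l| + ln `|w im_ix l|) <= al * (2 * ln (modulus w l)).
  by rewrite ler_wpM2l// ln_norm_add_le_modulus.
by rewrite mulrDr; lra.
Qed.

Section IntegralEstimate.
Variables (R : realType) (m : nat) (Phi : 'M[R]_(2, m.+1) -> R).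
Let N : R := m.+1%:R.
Hypothesis Phi_le0 : forall w, Phi (chart ord0 w) <= 0.
Hypothesis Phi_ge : forall w : 'M[R]_(2, m), (forall l, 0 < modulus w l) ->
  2 * \sum_l ln (modulus w l) - N * ln (1 + sqnorm w) <= Phi (chart ord0 w).

Variables (alpha al ga : R).
Hypotheses (alpha_le : alpha <= al) (al_ge0 : 0 <= al) (al_lt1 : al < 1).
Hypotheses (al_ga : 1 < al + 2 * ga) (ga_le : ga * (2 * m%:R) <= (1 - al) * N).

Lemma integrand_le (w : 'M[R]_(2, m)) : (forall r c, w r c != 0) ->
  expR (- (alpha * Phi (chart ord0 w))) * vol_density N w <=
  N ^+ m * \prod_l (radial_weight al ga (w re_ix l) * radial_weight al ga (w im_ix l)).
Proof.
move=> w0; rewrite vol_densityE mulrCA ler_wpM2l ?exprn_ge0// ?ler0n//.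
have ga_ge0 : 0 <= ga by move: al_lt1 al_ga; lra.
apply: le_trans (le_prod_radial_weight al_ge0 ga_ge0 ga_le w0).
have S0 := sqnorm1_gt0 w.
have -> : (1 + sqnorm w) ^- m.+1 = expR (- (N * ln (1 + sqnorm w))).
  by rewrite expRN expRM_natl lnK ?posrE.
rewrite -expRD ler_expR.
have := ler_wpM2l al_ge0 (Phi_ge (fun l => modulus_gt0 (w0 re_ix l))).
have : al * Phi (chart ord0 w) <= alpha * Phi (chart ord0 w) by rewrite ler_wnM2r.
by rewrite mulrBr mulrBl mul1r; lra.
Qed.

Lemma integral_exp_le : (integral_exp N alpha Phi <=
  (N ^+ m * (\int[lebesgue_measure]_t radial_weight al ga t) ^+ (2 * m))%:E)%E.
Proof.
have N_ge0 : 0 <= N ^+ m by rewrite exprn_ge0// ler0n.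
apply: iter_int_le_prod => // [t||x|x x0].
- exact: radial_weight_ge0.
- exact: integrable_radial_weight.
- rewrite lee_fin vol_densityE mulr_ge0 ?expR_ge0// divr_ge0// exprn_ge0// ltW//.
  exact: sqnorm1_gt0.
rewrite lee_fin (big_pairs _ _ (fun i => radial_weight al ga (x i))).
have := @integrand_le (mx_of_coords x); under eq_bigr do rewrite !mxE/=.
apply => r c; rewrite mxE; apply: x0.
by have := ltn_ord c; have := ltn_ord r; lia.
Qed.

End IntegralEstimate.

Lemma exists_weight_exponent (R : realFieldType) (m : nat) (b : R) : 0 < b ->
  exists ga, b < 2 * ga /\ ga * (2 * m%:R) <= b * m.+1%:R.
Proof.
move=> b0; exists (b / 2 * (1 + m.+1%:R^-1)); set V := m.+1%:R^-1.
have mV : m%:R * V <= 1 :> R by rewrite ler_pdivrMr// mul1r ler_nat.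
have bV : 0 < b * V by rewrite mulr_gt0// invr_gt0.
have bmV : b * (m%:R * V) <= b * 1 by rewrite ler_pM2l.
clearbody V; split; first lra.
have -> : b / 2 * (1 + V) * (2 * m%:R) = b * m%:R + b * (m%:R * V) by field.
by rewrite -natr1 mulrDr lerD2l.
Qed.

Theorem theorem2 (R : realType) (k n : nat) :
  (1 <= k)%N -> (1 <= n)%N ->
  forall alpha : R, alpha < 1 ->
  exists C : R,
    forall Phi : 'M[R]_(2, (k * n).-1.+1) -> R,
      proj_invariant Phi ->
      smooth_on [set Z | Z != 0] Phi ->
      admissible ((k * n).-1.+1)%:R Phi ->
      Gnk_invariant k n Phi ->
      sup [set Phi Z | Z in [set Z | Z != 0]] = 0 ->
      (integral_exp ((k * n).-1.+1)%:R alpha Phi <= C%:E)%E.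
Proof.
move=> k1 n1 alpha alpha1.
have mkn : (k * n).-1.+1 = (k * n)%N by rewrite prednK// muln_gt0 k1 n1.
move: ((k * n).-1) mkn => m mkn.
pose al := Num.max alpha 0.
have alpha_le : alpha <= al by rewrite le_max lexx.
have al_ge0 : 0 <= al by rewrite le_max lexx orbT.
have al_lt1 : al < 1 by rewrite gt_max alpha1 ltr01.
have [ga [al_ga ga_le]] := exists_weight_exponent m (etrans (subr_gt0 al 1) al_lt1).
exists (m.+1%:R ^+ m * (\int[lebesgue_measure]_t radial_weight al ga t) ^+ (2 * m)).
move=> Phi Phi_proj Phi_smooth Phi_adm Phi_inv Phi_sup.
have Phi_rot := Gnk_rotation_invariant Phi_inv.
have Phi_partials : equal_partials_at_ones Phi.
  exact: Gnk_equal_partials_at_ones Phi_inv (diter_differentiable Phi_smooth [::] (ones_neq0 R m)).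
apply: integral_exp_le => // [w|w w_gt0|]; last by lra.
- by apply: (potential_le0 (ler0n R m.+1)) => //; exact: chart_neq0.
- have := potential_chart_ge (ler0n R m.+1) Phi_proj Phi_smooth Phi_adm Phi_rot Phi_partials Phi_sup
    ord0 w_gt0.
  by rewrite mulfK ?pnatr_eq0.
Qed.
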